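(* Let $G=\mathrm{USp}(4)$ and let $H=\mathrm{SU}(2)\times\mathrm{SU}(2)$, embedded block-diagonally in $G$. For $g\in G$ with eigenvalues $e^{\pm i\theta_1},e^{\pm i\theta_2}$, let $s_1(g)=\mathrm{tr}(g)=2\cos\theta_1+2\cos\theta_2\in[-4,4]$, and set $\varepsilon=s_1+4\in[0,8]$. Let $\mu_G(\varepsilon)$ and $\mu_H(\varepsilon)$ denote the push-forwards of the normalized Haar measures on $G$ and $H$ under $\varepsilon=s_1+4$. Then, as $\varepsilon\to 0^+$, $$\mu_G(\varepsilon)=\left(\frac{\varepsilon^4(8-\varepsilon)}{512\pi}+O(\varepsilon^6)\right)d\varepsilon=\left(\frac{\varepsilon^4}{64\pi}-\frac{\varepsilon^5}{512\pi}+O(\varepsilon^6)\right)d\varepsilon,$$ and $$\mu_H(\varepsilon)=\left(\frac{\varepsilon^2(8-\varepsilon)}{64\pi}+O(\varepsilon^4)\right)d\varepsilon=\left(\frac{\varepsilon^2}{8\pi}-\frac{\varepsilon^3}{64\pi}+O(\varepsilon^4)\right)d\varepsilon.$$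
   Context: $\mathrm{USp}(4)$ is the compact unitary symplectic group of $4\times 4$ matrices; every element has eigenvalues of the form $e^{\pm i\theta_1}, e^{\pm i\theta_2}$ with $\theta_j\in[0,\pi]$. $\mathrm{SU}(2)=\mathrm{USp}(2)$, and $H$ acts block-diagonally, so the trace of $(g_1,g_2)\in H$ is $\mathrm{tr}(g_1)+\mathrm{tr}(g_2)$. Haar measures are normalized to total mass $1$. *)

(* Defs.v *)
From HB Require Import structures.
From mathcomp Require Import all_boot all_order all_algebra.
From mathcomp Require Import all_classical all_reals all_analysis.
From mathcomp Require Import complex.
Set Implicit Arguments. Unset Strict Implicit. Unset Printing Implicit Defensive.
Import Order.TTheory GRing.Theory Num.Theory.
Local Open Scope classical_set_scope.
Local Open Scope ring_scope.

Section Defs.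
Variable R : realType.
Local Notation C := (complex R).

Definition adjmx n (A : 'M[C]_n) : 'M[C]_n := \matrix_(i, j) conjc (A j i).

Definition unitary n (A : 'M[C]_n) : Prop := A *m adjmx A = 1%:M.

Definition SU2 : set 'M[C]_2 := [set A | unitary A /\ \det A = 1].

(* the 2x2 standard symplectic form, and the 4x4 one  J = diag(J2, J2),
   chosen so that SU(2) x SU(2) sits block-diagonally in USp(4) *)
Definition J2 : 'M[C]_2 := \matrix_(i, j)
  (if (val i == 0%N) && (val j == 1%N) then 1
   else if (val i == 1%N) && (val j == 0%N) then -1 else 0).
Definition J4 : 'M[C]_4 := block_mx J2 0 0 J2.

Definition USp4 : set 'M[C]_4 :=
  [set g | unitary g /\ g^T *m J4 *m g = J4].

Definition Hsub : set 'M[C]_4 :=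
  [set g | exists a b : 'M[C]_2, SU2 a /\ SU2 b /\ g = block_mx a 0 0 b].

(* Borel sigma-algebra on M_4(C) = C^16 = R^32: generated by the real and
   imaginary parts of the entries *)
Definition M4 : Type := 'M[C]_4.
HB.instance Definition _ := Choice.on M4.
HB.instance Definition _ := isPointed.Build M4 (0 : 'M[C]_4).

Definition mx_gen : set (set M4) :=
  [set A | exists (i j : 'I_4) (B : set R), measurable B /\
     (A = [set g : M4 | B (complex.Re (g i j))] \/ A = [set g : M4 | B (complex.Im (g i j))])].

Definition MX4 := g_sigma_algebraType mx_gen.

(* a Haar probability measure of a compact subgroup K (viewed as a Borel
   probability measure on M_4(C) concentrated on K, left-invariant under K) *)
Definition haar_prob (K : set 'M[C]_4) (mu : {measure set MX4 -> \bar R}) :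
  Prop :=
  mu setT = 1%E /\ mu (~` K) = 0%E /\
  forall k, K k -> forall A : set MX4, measurable A ->
    mu [set g : MX4 | A (k *m g)] = mu A.

Definition epsf (g : 'M[C]_4) : R := complex.Re (\tr g) + 4.

Definition push_eps (mu : {measure set MX4 -> \bar R}) (B : set R) : \bar R :=
  mu [set g : MX4 | B (epsf g)].

(* nu = (f(e) + O(e^k)) de as e -> 0+: near 0 (on some [0, delta]) nu has
   a density d with |d e - f e| <= C e^k for 0 < e < delta *)
Definition density_asymp (nu : set R -> \bar R) (f : R -> R) (k : nat) :
  Prop :=
  exists (d : R -> R) (delta Cst : R), 0 < delta /\
    measurable_fun `[0, delta] d /\
    (forall B : set R, measurable B -> B `<=` `[0, delta] ->
       nu B = (\int[lebesgue_measure]_(x in B) (d x)%:E)%E) /\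
    (forall e, 0 < e < delta -> `|d e - f e| <= Cst * e ^+ k).

End Defs.

(* Main.v *)
Require Import Defs.
From HB Require Import structures.
From mathcomp Require Import all_boot all_order all_algebra.
From mathcomp Require Import all_classical all_reals all_analysis.
From mathcomp Require Import measurable_realfun complex ring lra.
(** Method of moments. Write the first column of the quaternionic 2 x 2 matrix
    [g] as (a, c), its last diagonal entry as d, so that tr g = 2 Re a + 2 Re d
    and |a| = |d|. Left-invariance of Haar measure under the rotations
    x |-> c x + s y of coordinates gives, by comparing coefficients of the
    rotation parameter, the recursion (m + 1) E[x^m y^2 D] = E[x^(m+2) D].
    Summing over the imaginary directions of SU(2), the moments of 2 Re a and
    2 Re d are those of two independent semicircular variables scaled by |a|;
    summing over the seven directions of S^7 shows that |a|^2 has the moments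
    6 / ((m + 2) (m + 3)) of the Beta(2, 2) law. A recursion for the mixed
    semicircle moments then identifies the moments of tr g with those of the
    convolution density [\int Q(x, y) w(x) w(y)] over x + y = e - 4, where w is the
    semicircle density and Q is 1 for SU(2) x SU(2) and (x - y)^2 / 2 for USp(4).
    Moments determine the law: polynomials (1 - t^n)^(n 2^n) converge to the
    indicator of t < 1/2 on [0, 1]. Rescaling the convolution integral at the edge
    e -> 0 yields the expansions. *)

Set Implicit Arguments. Unset Strict Implicit. Unset Printing Implicit Defensive.
Import Order.TTheory GRing.Theory Num.Theory.
Import numFieldNormedType.Exports.
Local Open Scope classical_set_scope.
Local Open Scope ring_scope.


(** The hypothesis [haar_prob] speaks of left translations only, so Weyl's density is reached
    through moments and no eigenvalue is computed. Left multiplication acts on each column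
    separately. A block-diagonal factor turns the upper half of the first column and the lower half
    of the third one independently: hence the product form of the mixed moments of the two diagonal
    traces, given |a|. The law of |a| requires rotations mixing the two halves; these disturb the
    second diagonal trace and are applied only to moments of the first. The pair (2 Re a, 2 Re d)
    does not have the law of (2 cos theta_1, 2 cos theta_2), whose density w(x) w(y) (x - y)^2 / 2
    vanishes on the diagonal. Only the sums agree in law, which is why [mixmom_weyl] compares
    moments of sums. At the lower edge two square-root zeros convolve to order e^2, and (x - y)^2
    adds another e^2: hence the exponents 2 and 4. *)

Definition mixmom (R : pzSemiRingType) (c : nat -> R) (n i j : nat) : R :=
  \sum_(p < n.+1) 'C(n, p)%:R * (c (p + i)%N * c (n - p + j)%N).

(** * Mixed moments of two semicircular variables *)

Section semicircle_moments.
Variables (R : realFieldType) (c : nat -> R).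
Hypothesis c1 : c 1%N = 0.
Hypothesis cS : forall p, (p%:R + 4) * c p.+2 = 4 * (p%:R + 1) * c p.

(** [mixmom c n i j] is E[(x + y)^n x^i y^j] for independent x and y with moments [c]; exchanging x
    and y reverses the binomial sum. *)
Lemma mixmom_sym n i j : mixmom c n i j = mixmom c n j i.
Proof.
rewrite /mixmom (reindex_inj rev_ord_inj); apply: eq_bigr => p _ /=.
have pn : (p <= n)%N by rewrite -ltnS.
by rewrite subSS subKn// bin_sub// [c _ * _]mulrC.
Qed.

(** Splitting off one factor x + y; on coefficients this is Pascal's rule. *)
Lemma mixmomS n i j : mixmom c n.+1 i j = mixmom c n i.+1 j + mixmom c n i j.+1.
Proof.
rewrite /mixmom big_ord_recl /= bin0 subn0 add0n.
have -> : \sum_(p < n.+1) 'C(n.+1, bump 0 p)%:R *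
    (c (bump 0 p + i)%N * c (n.+1 - bump 0 p + j)%N) =
  \sum_(p < n.+1) 'C(n, p)%:R * (c (p + i.+1)%N * c (n - p + j)%N) +
  \sum_(p < n.+1) 'C(n, p.+1)%:R * (c (p + i.+1)%N * c (n - p + j)%N).
  rewrite -big_split; apply: eq_bigr => p _ /=.
  by rewrite /bump /= add1n subSS binS natrD mulrDl addSnnS addrC.
rewrite addrCA; congr (_ + _).
rewrite [X in _ + X]big_ord_recr /= bin_small// mul0r addr0.
rewrite [RHS]big_ord_recl /= bin0 subn0 add0n addSnnS; congr (_ + _).
apply: eq_bigr => p _ /=.
by rewrite /bump /= add1n addSnnS; have -> : (n - p + j)%N = (n - p.+1 + j.+1)%N
  by rewrite addnS -addSn -subSn// subSS.
Qed.

(** Stein's identity E[f'(x) (4 - x^2)] = 3 E[x f(x)] of the semicircle law of radius 2, with f(x) =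
    (x + y)^(n+1) and y frozen. The hypotheses [cS] and [c1] are its cases f(x) = x^(p+1) and f =
    1. *)
Lemma mixmom_stein n j :
  (n%:R + 1) * (4 * mixmom c n 0 j - mixmom c n 2 j) = 3 * mixmom c n.+1 1 j.
Proof.
rewrite /mixmom [in RHS]big_ord_recl /= bin0 add0n c1 mul0r mulr0 add0r.
rewrite [in RHS]mulr_sumr mulr_sumr -sumrB mulr_sumr; apply: eq_bigr => p _.
rewrite /bump /= add1n subSS addn0 addn1 addn2.
(* The derivative of the monomials: (n+1) C(n, p) = (p+1) C(n+1, p+1). *)
have /(congr1 (fun k => k%:R : R)) := mul_bin_diag n.+1 p.
rewrite !natrM -!natr1 => /= binE.
have cSp := cS p.
transitivity (((n%:R + 1) * 'C(n, p)%:R) * ((4 * c p - c p.+2) * c (n - p + j)%N)).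
  by ring.
rewrite binE.
transitivity ('C(n.+1, p.+1)%:R * (4 * (p%:R + 1) * c p - (p%:R + 1) * c p.+2)
  * c (n - p + j)%N); first by ring.
by rewrite -cSp; ring.
Qed.

(* The Weyl weight (x - y)^2 / 2 for USp(4) only rescales the n-th moment of
   x + y; since odd moments vanish, the factor is 6 / ((m + 2) (m + 3)) at
   n = 2 m, the m-th moment of the Beta(2, 2) law. *)
Lemma mixmom_weyl n :
  (n%:R + 4) * (n%:R + 6) * (mixmom c n 2 0 - mixmom c n 1 1) =
  24 * mixmom c n 0 0.
Proof.
have e1 := mixmom_stein n 0.
rewrite mixmomS in e1.
(* By symmetry a factor y counts for half of x + y, and x^2 y for half of (x + y) x y. Stein's
   identity with j = 1 thus closes on these two moments. *)
have e2 : (n%:R + 6) * mixmom c n 1 1 = 4 * n%:R * mixmom c n 0 0.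
  case: n {e1} => [|n].
    by rewrite /mixmom !big_ord1 /= add0n c1 !(mul0r, mulr0).
  have e3 := mixmom_stein n 1.
  have e4 := mixmomS n 0 0; have e5 := mixmomS n 1 1.
  have s4 := mixmom_sym n 0 1; have s5 := mixmom_sym n 1 2.
  rewrite s5 in e5; rewrite s4 in e3 e4; rewrite e5 in e3; rewrite e4 e5 -natr1.
  by move: e3; lra.
have : (n%:R + 6) * ((n%:R + 4) * mixmom c n 2 0 + 3 * mixmom c n 1 1) =
  (n%:R + 6) * (4 * (n%:R + 1) * mixmom c n 0 0).
  by congr (_ * _); have := e1; lra.
have -> : (n%:R + 4) * (n%:R + 6) * (mixmom c n 2 0 - mixmom c n 1 1) =
 (n%:R + 6) * ((n%:R + 4) * mixmom c n 2 0 + 3 * mixmom c n 1 1)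
  - (n%:R + 7) * ((n%:R + 6) * mixmom c n 1 1) by ring.
by move=> ->; rewrite e2; ring.
Qed.

End semicircle_moments.

(** * Quaternionic structure of USp(4) *)

Section quaternionic_matrices.
Variable R : realType.
Local Notation C := (complex R).

(** The quaternions inside the 2 x 2 complex matrices, indexed by their first column because left
    multiplication acts on columns. *)
Definition quat (a b : C) : 'M[C]_2 := \matrix_(i, j)
  (if i == 0 then if j == 0 then a else - conjc b
   else if j == 0 then b else conjc a).

Definition normsq (z : C) : R := complex.Re z ^+ 2 + complex.Im z ^+ 2.

Definition conjmx m n (A : 'M[C]_(m, n)) : 'M[C]_(m, n) := map_mx (@conjc R) A.

Lemma adjmxE n (A : 'M[C]_n) : adjmx A = (conjmx A)^T.
Proof. by apply/matrixP => i j; rewrite !mxE. Qed.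

Lemma sum2 (V : nmodType) (F : 'I_2 -> V) : \sum_i F i = F 0 + F 1.
Proof.
by rewrite big_ord_recl big_ord1; congr (F _ + F _); apply: val_inj.
Qed.

Lemma ord2P (P : 'I_2 -> Prop) : P 0 -> P 1 -> forall i, P i.
Proof.
by move=> P0 P1 [[|[|//]] lt]; [move: P0|move: P1]; congr (P _); apply: val_inj.
Qed.

Ltac mx2_ring := apply/matrixP; apply: ord2P; apply: ord2P;
  rewrite !(mxE, sum2) /=;
  apply/eqP; rewrite eq_complex /=; apply/andP; split; apply/eqP; ring.

Lemma J2E : J2 R = quat 0 (- 1).
Proof. by mx2_ring. Qed.

Lemma quatM a b c d :
  quat a b *m quat c d = quat (a * c - conjc b * d) (b * c + conjc a * d).
Proof. by case: a b c d => [? ?] [? ?] [? ?] [? ?]; mx2_ring. Qed.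

Lemma quat0 : quat 0 0 = 0.
Proof. by mx2_ring. Qed.

Lemma quat1 (c : R) : quat c%:C%C 0 = (c%:C%C)%:M.
Proof. by mx2_ring. Qed.

Lemma adj_quat a b : adjmx (quat a b) = quat (conjc a) (- b).
Proof. by case: a b => [? ?] [? ?]; mx2_ring. Qed.

Lemma conj_quat a b : conjmx (quat a b) = quat (conjc a) (conjc b).
Proof. by case: a b => [? ?] [? ?]; mx2_ring. Qed.

Lemma det2 (A : 'M[C]_2) : \det A = A 0 0 * A 1 1 - A 0 1 * A 1 0.
Proof.
rewrite (expand_det_row _ 0) sum2 /cofactor !det_mx11 !mxE /=.
rewrite expr0 expr1 mul1r mulN1r mulrN.
by congr (_ * A _ _ - _ * A _ _); apply: val_inj.
Qed.

Lemma det_quat a b : \det (quat a b) = (normsq a + normsq b)%:C%C.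
Proof.
rewrite det2 !mxE /= /normsq; case: a b => [x y] [z t] /=.
by apply/eqP; rewrite eq_complex /=; apply/andP; split; apply/eqP; ring.
Qed.

Lemma quat_adjM a b : quat a b *m adjmx (quat a b) = (normsq a + normsq b)%:C%C%:M.
Proof.
rewrite adj_quat quatM -quat1 /normsq; case: a b => [x y] [z t] /=.
by congr quat; apply/eqP; rewrite eq_complex /=; apply/andP; split; apply/eqP; ring.
Qed.

Lemma adj_quatM a b : adjmx (quat a b) *m quat a b = (normsq a + normsq b)%:C%C%:M.
Proof.
rewrite adj_quat quatM -quat1 /normsq; case: a b => [x y] [z t] /=.
by congr quat; apply/eqP; rewrite eq_complex /=; apply/andP; split; apply/eqP; ring.
Qed.

Lemma quat_trJ a b : (quat a b)^T *m J2 R = J2 R *m adjmx (quat a b).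
Proof. by rewrite J2E adj_quat; case: a b => [? ?] [? ?]; mx2_ring. Qed.

Lemma quat_J a b : conjmx (quat a b) *m J2 R = J2 R *m quat a b.
Proof. by rewrite J2E conj_quat; case: a b => [? ?] [? ?]; mx2_ring. Qed.

Lemma adj_block (A B C0 D : 'M[C]_2) :
  adjmx (block_mx A B C0 D) =
  block_mx (adjmx A) (adjmx C0) (adjmx B) (adjmx D).
Proof. by rewrite !adjmxE /conjmx map_block_mx tr_block_mx. Qed.

Lemma adjmx0 : adjmx (0 : 'M[C]_2) = 0.
Proof. by rewrite -quat0 adj_quat conjc0 oppr0. Qed.

Lemma adjmxK n : involutive (@adjmx R n).
Proof. by move=> A; apply/matrixP => i j; rewrite !mxE conjcK. Qed.

Lemma adjmxN n (A : 'M[C]_n) : adjmx (- A) = - adjmx A.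
Proof. by apply/matrixP => i j; rewrite !mxE rmorphN. Qed.

Lemma adj_scalar n (c : R) : adjmx (c%:C%C%:M : 'M[C]_n) = c%:C%C%:M.
Proof.
apply/matrixP => i j; rewrite !mxE eq_sym.
by case: eqP; rewrite /= ?oppr0.
Qed.

Lemma quat_SU2 a b : normsq a + normsq b = 1 -> SU2 (quat a b).
Proof.
by move=> ab1; split; rewrite ?det_quat /unitary ?quat_adjM ab1.
Qed.

(** In size 2, [D^T J D] equals [(det D) J], so determinant one is the symplectic condition on each
    block. *)
Lemma SU2_USp4 (A B : 'M[C]_2) : SU2 A -> SU2 B -> USp4 (block_mx A 0 0 B).
Proof.
have JE (D : 'M[C]_2) : SU2 D -> D^T *m J2 R *m D = J2 R.
  move=> [_ D1]; rewrite -[RHS]scale1r -D1.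
  apply/matrixP; apply: ord2P; apply: ord2P;
  by rewrite det2 !(mxE, sum2) /=; ring.
move=> sA sB; have [uA _] := sA; have [uB _] := sB; split.
  (* The size 4 is exposed as 2 + 2, the shape that the block lemmas match. *)
  change (@unitary R (2 + 2) (block_mx A 0 0 B)).
  rewrite /unitary adj_block adjmx0 mulmx_block !mulmx0 !mul0mx !addr0 add0r.
  by rewrite uA uB -scalar_mx_block.
change ((block_mx A 0 0 B)^T *m block_mx (J2 R) 0 0 (J2 R) *m block_mx A 0 0 B =
  block_mx (J2 R) 0 0 (J2 R)).
rewrite tr_block_mx !trmx0 !mulmx_block !(mulmx0, mul0mx, addr0, add0r).
by rewrite !JE.
Qed.

(** A plane rotation over the quaternions, with a real cosine [c] and a quaternion as sine. It
    reaches the four directions of S^7 that block-diagonal matrices cannot. *)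
Definition rotmx (c : R) (a b : C) : 'M[C]_(2 + 2) :=
  block_mx (c%:C%C%:M) (- adjmx (quat a b)) (quat a b) (c%:C%C%:M).

(** [quat_trJ] and [quat_J] carry [J2] across the quaternion, which reduces the symplectic condition
    to the computation made for unitarity. *)
Lemma rotmx_USp4 c a b : c ^+ 2 + (normsq a + normsq b) = 1 ->
  USp4 (rotmx c a b).
Proof.
move=> cab; have cab' : c%:C%C%:M *m c%:C%C%:M + (normsq a + normsq b)%:C%C%:M =
    1%:M :> 'M[C]_2.
  rewrite -scalar_mxM -(raddfD (@scalar_mx C 2)) /=; congr (_%:M).
  by apply/eqP; rewrite eq_complex /=; apply/andP; split; apply/eqP;
    rewrite -?cab; ring.
have E (A : 'M[C]_2) : A *m (c%:C%C%:M) = (c%:C%C%:M) *m A by rewrite scalar_mxC.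
split.
  change (@unitary R (2 + 2) (rotmx c a b)).
  rewrite /unitary /rotmx adj_block !adjmxN adjmxK !adj_scalar mulmx_block.
  rewrite !mulNmx !mulmxN !opprK quat_adjM adj_quatM.
  by rewrite cab' [X in block_mx _ _ _ X]addrC cab' !E !subrr -scalar_mx_block.
change ((rotmx c a b)^T *m block_mx (J2 R) 0 0 (J2 R) *m rotmx c a b =
  block_mx (J2 R) 0 0 (J2 R)).
rewrite /rotmx tr_block_mx !tr_scalar_mx.
rewrite !mulmx_block !(mulmx0, mul0mx, addr0, add0r) quat_trJ.
have -> : (- adjmx (quat a b))^T = - conjmx (quat a b).
  by rewrite adjmxE linearN /= trmxK.
rewrite !mulNmx quat_J !mulmxN -!mulmxA adj_quatM quat_adjM !E !mulmxA.
rewrite !(E (J2 R)) !addNr opprK !(scalar_mxC _ (J2 R)) -!mulmxDl.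
by rewrite [X in block_mx _ _ _ (X *m _)]addrC cab' mul1mx.
Qed.

(* For quaternionic unitary matrices [J4 g = conj(g) J4], which identifies the
   2x2 blocks of [g] with quaternions. *)
Lemma USp4_blocks (g : 'M[C]_(2 + 2)) : USp4 g ->
  exists a b c d e f h k : C,
    [/\ g = block_mx (quat a b) (quat c d) (quat e f) (quat h k),
     normsq a + normsq b = normsq h + normsq k &
     normsq a + normsq b + (normsq e + normsq f) = 1].
Proof.
move=> [ug sg].
have Jg : J4 R *m g = conjmx g *m J4 R.
  rewrite -[in RHS]sg !mulmxA.
  suff -> : conjmx g *m g^T = 1%:M by rewrite mul1mx.
  have /(congr1 (@conjmx 4 4)) := ug; rewrite adjmxE /conjmx.
  rewrite map_mxM /= map_mx1 => <-; congr (_ *m _).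
  by apply/matrixP => i j; rewrite !mxE conjcK.
have J2A (A : 'M[C]_2) : J2 R *m A = conjmx A *m J2 R -> A = quat (A 0 0) (A 1 0).
  move=> /matrixP JA; apply/matrixP; apply: ord2P; apply: ord2P; rewrite !mxE //=.
    have := JA 1 1; rewrite !mxE !sum2 !mxE /=.
    by rewrite !(mul0r, mulr0, mulN1r, mulr1, mul1r, addr0, add0r) => <-; rewrite opprK.
  have := JA 0 1; rewrite !mxE !sum2 !mxE /=.
  by rewrite !(mul0r, mulr0, mulN1r, mulr1, mul1r, addr0, add0r).
have {}Jg : block_mx (J2 R) 0 0 (J2 R) *m g =
  conjmx g *m block_mx (J2 R) 0 0 (J2 R) := Jg.
have {}ug : g *m @adjmx R (2 + 2) g = 1%:M := ug.
move: ug Jg; rewrite -(submxK g).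
move: (ulsubmx g) (ursubmx g) (dlsubmx g) (drsubmx g) => A B A' B' ug.
rewrite /conjmx map_block_mx !mulmx_block !(mul0mx, mulmx0, addr0, add0r).
move=> /eq_block_mx[/J2A eA /J2A eB /J2A eA' /J2A eB'].
move: ug; rewrite eA eB eA' eB'.
move: (A 0 0) (A 1 0) (B 0 0) (B 1 0) (A' 0 0) (A' 1 0) (B' 0 0) (B' 1 0).
move=> a b c d e f h k ug.
exists a, b, c, d, e, f, h, k.
have scalar1 (x y : R) : x%:C%C%:M + y%:C%C%:M = 1%:M :> 'M[C]_2 -> x + y = 1.
  by move=> /matrixP/(_ 0 0); rewrite !mxE /= !mulr1n => -[].
(* The second block row and the first block column both have norm one and share the lower left
   block, so the two diagonal blocks have equal norm. *)
have := mulmx1C ug; move: ug.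
rewrite adj_block !mulmx_block !quat_adjM !adj_quatM !(scalar_mx_block 2 2 1).
move=> /eq_block_mx[_ _ _ /scalar1 r2] /eq_block_mx[/scalar1 c1 _ _ _].
by split=> //; rewrite -[RHS](addKr (normsq e + normsq f)) r2 -c1; ring.
Qed.

Lemma quat00 a b : quat a b 0 0 = a. Proof. by rewrite mxE. Qed.
Lemma quat10 a b : quat a b 1 0 = b. Proof. by rewrite mxE. Qed.




End quaternionic_matrices.

(** * Moment recursions from rotation invariance *)

Section almost_surely_bounded.
Context d (T : measurableType d) (R : realType) (mu : {measure set T -> \bar R}).
Variable K : set T.
Hypothesis mu1 : mu setT = 1%E.
Hypothesis mK : measurable K.
Hypothesis muK : mu (~` K) = 0%E.

(** The bound is asked on [K] only: matrix entries are unbounded on the ambient space, but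
    integrable for a probability measure concentrated on [K]. *)
Definition bounded_on (f : T -> R) : Prop :=
  measurable_fun setT f /\ exists M, forall g, K g -> `|f g| <= M.

Lemma bounded_on_cst c : bounded_on (fun=> c).
Proof. by split; [exact: measurable_cst|exists `|c|]. Qed.

Lemma bounded_onD f g : bounded_on f -> bounded_on g ->
  bounded_on (fun x => f x + g x).
Proof.
move=> [mf [M fM]] [mg [N gN]]; split; first exact: measurable_funD.
exists (M + N) => x Kx; apply: le_trans (ler_normD _ _) _.
by apply: lerD; [exact: fM|exact: gN].
Qed.

Lemma bounded_onM f g : bounded_on f -> bounded_on g ->
  bounded_on (fun x => f x * g x).
Proof.
move=> [mf [M fM]] [mg [N gN]]; split; first exact: measurable_funM.
exists (M * N) => x Kx; rewrite normrM.
by apply: ler_pM => //; [exact: fM|exact: gN].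
Qed.

Lemma bounded_onN f : bounded_on f -> bounded_on (fun x => - f x).
Proof.
move=> /(bounded_onM (bounded_on_cst (-1))) [h1 h2]; split.
  by apply: eq_measurable_fun h1 => x _; rewrite mulN1r.
by case: h2 => M h2; exists M => g /h2; rewrite mulN1r.
Qed.

Lemma bounded_onX f n : bounded_on f -> bounded_on (fun x => f x ^+ n).
Proof.
move=> bf; elim: n => [|n IHn].
  by under eq_fun do rewrite expr0; exact: bounded_on_cst.
by under eq_fun do rewrite exprS; exact: bounded_onM.
Qed.

Lemma bounded_on_sum n (F : 'I_n -> T -> R) : (forall i, bounded_on (F i)) ->
  bounded_on (fun x => \sum_i F i x).
Proof.
elim: n F => [|n IHn] F bF.
  by under eq_fun do rewrite big_ord0; exact: bounded_on_cst.
under eq_fun do rewrite big_ord_recl; apply: bounded_onD => //.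
exact: IHn.
Qed.

Lemma bounded_on_integrable f : bounded_on f -> mu.-integrable setT (EFin \o f).
Proof.
move=> [mf [M fM]].
apply/(@negligible_integrable _ _ _ mu setT (~` K)) => //.
- exact: measurableC.
- exact/measurable_EFinP.
rewrite setTD setCK.
apply: measurable_bounded_integrable => //.
- have : (mu K <= mu setT)%E by apply: le_measure; rewrite ?inE.
  by rewrite mu1 => /le_lt_trans; apply; rewrite ltry.
- exact: measurable_funS mf.
- exists M; split; first exact: num_real.
  by move=> N MN x Kx; apply: le_trans (fM _ Kx) (ltW MN).
Qed.

Local Notation E f := (\int[mu]_x (f x))%R.

Lemma as_RintegralZl c f : bounded_on f -> E (fun x => c * f x) = c * E f.
Proof. by move=> bf; rewrite RintegralZl//; exact: bounded_on_integrable. Qed.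

Lemma as_RintegralD f g : bounded_on f -> bounded_on g ->
  E (fun x => f x + g x) = E f + E g.
Proof. by move=> bf bg; rewrite RintegralD//; exact: bounded_on_integrable. Qed.

Lemma as_RintegralB f g : bounded_on f -> bounded_on g ->
  E (fun x => f x - g x) = E f - E g.
Proof. by move=> bf bg; rewrite RintegralB//; exact: bounded_on_integrable. Qed.

Lemma as_Rintegral_sum n (F : 'I_n -> T -> R) : (forall i, bounded_on (F i)) ->
  E (fun x => \sum_i F i x) = \sum_i E (F i).
Proof.
elim: n F => [|n IHn] F bF.
  rewrite big_ord0; under eq_Rintegral do rewrite big_ord0.
  by rewrite Rintegral_cst// mul0r.
under eq_Rintegral do rewrite big_ord_recl.
rewrite as_RintegralD//; last exact: bounded_on_sum.
by rewrite IHn// big_ord_recl.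
Qed.

Lemma prob_Rintegral_cst c : E (fun=> c) = c.
Proof. by rewrite Rintegral_cst//= mu1 mulr1. Qed.

Lemma as_eq_Rintegral f g : bounded_on f -> bounded_on g -> (forall x, K x -> f x = g x) ->
  E f = E g.
Proof.
move=> [mf _] [mg _] fg; congr fine; apply: ae_eq_integral => //;
  do ?exact/measurable_EFinP.
exists (~` K); split => //; first exact: measurableC.
by move=> x /= h Kx; apply: h => _; rewrite fg.
Qed.

End almost_surely_bounded.

(** * Rotation invariance as a polynomial identity *)

Section rotation_moments.
Context d (T : measurableType d) (R : realType) (mu : {measure set T -> \bar R}).
Variable K : set T.
Hypothesis mu1 : mu setT = 1%E.
Hypothesis mK : measurable K.
Hypothesis muK : mu (~` K) = 0%E.

Local Notation bounded_on := (bounded_on K).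
Local Notation E f := (\int[mu]_x (f x))%R.

Definition preserves (phi : T -> T) : Prop :=
  measurable_fun setT phi /\ forall A, measurable A -> mu (phi @^-1` A) = mu A.

Lemma Rintegral_preserves phi f : preserves phi -> measurable_fun setT f ->
  bounded_on (f \o phi) -> E (f \o phi) = E f.
Proof.
move=> [mphi phimu] mf bfp; congr fine.
have ip : mu.-integrable (phi @^-1` setT) ((EFin \o f) \o phi).
  by rewrite preimage_setT; exact: (bounded_on_integrable mu1 mK muK bfp).
have mEf : measurable_fun setT (EFin \o f) by exact/measurable_EFinP.
have := @integral_pushforward _ _ _ _ _ phi mphi mu setT (EFin \o f) mEf ip.
rewrite preimage_setT => /(_ measurableT) /= <-.
apply: eq_measure_integral => A mA _; exact: phimu.
Qed.

Lemma poly_eq0_of_horner (p : {poly R}) : (forall t, p.[t] = 0) -> p = 0.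
Proof.
move=> p0; apply: (@roots_geq_poly_eq0 _ p [seq i%:R | i <- iota 0 (size p)]).
- by apply/allP => t _; rewrite rootE p0.
- rewrite map_inj_uniq ?iota_uniq// => i j /eqP.
  by rewrite eqr_nat => /eqP.
- by rewrite size_map size_iota.
Qed.

(** Expansion modulo X^3: the recursions come from the coefficient of X^2. *)
Lemma expr_1DcX2 (c : R) k : exists r : {poly R},
  (1 + c *: 'X^2) ^+ k = 1 + (c *+ k) *: 'X^2 + 'X^3 * r.
Proof.
elim: k => [|k [r IHk]].
  by exists 0; rewrite expr0 mulr0n scale0r addr0 mulr0 addr0.
exists ((c * (c *+ k)) *: 'X + (1 + c *: 'X^2) * r).
rewrite exprS IHk -!mul_polyC mulrS !polyCD !polyCM.
ring.
Qed.

Lemma coef_1DcX2 (c : R) k : [/\ ((1 + c *: 'X^2) ^+ k)`_0 = 1,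
  ((1 + c *: 'X^2) ^+ k)`_1 = 0 & ((1 + c *: 'X^2) ^+ k)`_2 = c *+ k].
Proof.
have [r ->] := expr_1DcX2 c k.
by split; rewrite !coefD coefXnM coef1 coefZ coefXn /= ?(mulr0, mulr1, addr0, add0r).
Qed.

(** Only [x] and [D] are followed under [phi]: a single application turns E[x^m D] into
    E[(c x + s y)^m D], which is expanded in the original x and y. *)
Definition rotates (x y D : T -> R) := forall c s, c ^+ 2 + s ^+ 2 = 1 ->
  exists2 phi, preserves phi &
    forall g, x (phi g) = c * x g + s * y g /\ D (phi g) = D g.

Variables x y D : T -> R.
Hypotheses (bx : bounded_on x) (by_ : bounded_on y) (bD : bounded_on D).
Hypothesis xyD : rotates x y D.

Let e m i := E (fun g => x g ^+ (m - i) * y g ^+ i * D g).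

Lemma bounded_on_xyD i j : bounded_on (fun g => x g ^+ i * y g ^+ j * D g).
Proof. by do ![apply: bounded_onM|apply: bounded_onX] => //. Qed.

(** The rational parametrization c = (1 - t^2) / (1 + t^2), s = 2 t / (1 + t^2) of the circle, with
    denominators cleared, makes both sides polynomial in t. *)
Lemma rotates_expand m t :
  \sum_(i < m.+1) 'C(m, i)%:R * (1 - t ^+ 2) ^+ (m - i) * (2 * t) ^+ i * e m i =
  (1 + t ^+ 2) ^+ m * e m 0.
Proof.
have t1 : 1 + t ^+ 2 != 0 by rewrite lt0r_neq0// ltr_pwDl// sqr_ge0.
pose c := (1 - t ^+ 2) / (1 + t ^+ 2); pose s := (2 * t) / (1 + t ^+ 2).
have cs : c ^+ 2 + s ^+ 2 = 1 by rewrite /c /s; field.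
have [phi pphi xphi] := xyD cs.
have bm i : bounded_on (fun g =>
    ('C(m, i)%:R * (1 - t ^+ 2) ^+ (m - i) * (2 * t) ^+ i) *
    (x g ^+ (m - i) * y g ^+ i * D g)).
  by apply: bounded_onM; [exact: bounded_on_cst|exact: bounded_on_xyD].
pose F := fun g => (1 + t ^+ 2) ^+ m * (x g ^+ (m - 0) * y g ^+ 0 * D g).
have FE : F \o phi = fun g => \sum_(i < m.+1)
    ('C(m, i)%:R * (1 - t ^+ 2) ^+ (m - i) * (2 * t) ^+ i) *
    (x g ^+ (m - i) * y g ^+ i * D g).
  apply/funext => g; rewrite /F /=; have [-> ->] := xphi g.
  rewrite subn0 expr0 mulr1 mulrA -exprMn.
  have -> : (1 + t ^+ 2) * (c * x g + s * y g) =
    (1 - t ^+ 2) * x g + (2 * t) * y g by rewrite /c /s; field.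
  rewrite exprDn mulr_suml; apply: eq_bigr => i _.
  rewrite !exprMn -mulr_natl; ring.
have bF : bounded_on F.
  by apply: bounded_onM; [exact: bounded_on_cst|exact: bounded_on_xyD].
have := Rintegral_preserves pphi bF.1; rewrite FE => /(_ (bounded_on_sum bm)).
rewrite (as_Rintegral_sum mu1 mK muK bm) /F (as_RintegralZl mu1 mK muK _ (bounded_on_xyD _ _)).
move=> <-; apply: eq_bigr => i _.
by rewrite (as_RintegralZl mu1 mK muK _ (bounded_on_xyD _ _)).
Qed.

Lemma rotates_poly m :
  \sum_(i < m.+1) ((1 + (-1) *: 'X^2) ^+ (m - i) * 'X^i) *
     ('C(m, i)%:R * 2 ^+ i * e m i)%:P =
  (1 + 1 *: 'X^2) ^+ m * (e m 0)%:P.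
Proof.
apply/eqP; rewrite -subr_eq0; apply/eqP/poly_eq0_of_horner => t.
rewrite !hornerE horner_sum; apply/eqP; rewrite subr_eq0; apply/eqP.
have := rotates_expand m t.
have -> : (1 + t ^+ 2) ^+ m * e m 0 = (1 + 1 *: 'X^2).[t] ^+ m * e m 0.
  by rewrite !hornerE ?mul1r.
rewrite -horner_exp => <-; apply: eq_bigr => i _.
have pE : (1 + (-1) *: 'X^2).[t] = 1 - t ^+ 2 by rewrite scaleN1r !hornerE.
rewrite !(hornerM, hornerC, hornerXn, horner_exp) pE exprMn.
by move: (_ ^+ (m - i)) (t ^+ i) (2 ^+ i) => A B C0; ring.
Qed.

(** At m = 1 the coefficient of t^2 reads - E[x D] = E[x D]. *)
Lemma rotates_moment1 : E (fun g => x g * D g) = 0.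
Proof.
have /(congr1 (fun p : {poly R} => p`_2)) := rotates_poly 1.
rewrite 2!big_ord_recl big_ord0 /= subnn bin0 binn !expr1 expr0 !mul1r mulr1.
rewrite addr0 coefD !coefMC !(coefE, scale1r) /=.
have -> : e 1 0 = E (fun g => x g * D g).
  by apply: eq_Rintegral => g _; rewrite subn0 expr1 expr0 mulr1.
lra.
Qed.

(** In degree m + 2, t^2 receives - (m + 2) E[x^(m+2) D] from i = 0, nothing from the odd term i =
    1, and 4 C(m + 2, 2) E[x^m y^2 D] from i = 2; the right-hand side gives (m + 2) E[x^(m+2) D]. *)
Lemma rotates_moment m :
  (m%:R + 1) * E (fun g => x g ^+ m * y g ^+ 2 * D g) =
  E (fun g => x g ^+ m.+2 * D g).
Proof.
have /(congr1 (fun p : {poly R} => p`_2)) := rotates_poly m.+2.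
rewrite 3!big_ord_recl !coefD !coefMC !coefMXn coef_sum big1 => [|i _]; last first.
  by rewrite coefMC coefMXn /= mul0r.
rewrite /= /bump /= !subn0 !add1n !subSS !subn0.
have [-> _ _] := coef_1DcX2 (-1) m; have [_ -> _] := coef_1DcX2 (-1) m.+1.
have [_ _ ->] := coef_1DcX2 (-1) m.+2; have [_ _ ->] := coef_1DcX2 1 m.+2.
rewrite mul0r mul1r addr0 add0r bin0 !mul1r.
have -> : e m.+2 0 = E (fun g => x g ^+ m.+2 * D g).
  by apply: eq_Rintegral => g _; rewrite subn0 expr0 mulr1.
have -> : e m.+2 2 = E (fun g => x g ^+ m * y g ^+ 2 * D g).
  by apply: eq_Rintegral => g _; rewrite !subSS subn0.
have -> : 'C(m.+2, 2)%:R = (m%:R + 2) * (m%:R + 1) / 2 :> R.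
  apply: (canRL (mulfK _)); first by rewrite pnatr_eq0.
  have := mul_bin_diag m.+2 1; rewrite bin1 /= => /(congr1 (fun k => k%:R : R)).
  by rewrite !natrM => h; rewrite mulrC -h -!natr1; ring.
move=> h; have m2 : m%:R + 2 != 0 :> R by rewrite -natrD pnatr_eq0 addn2.
apply: (mulfI m2); move: h; rewrite mulNrn.
have -> : m.+2%:R = m%:R + 2 :> R by rewrite -natrD addn2.
lra.
Qed.

End rotation_moments.

(** The y_i are the coordinates completing x to a point of a sphere; F expresses their sum of
    squares through x and the radius, which closes the recursion. *)
Lemma rotates_family d (T : measurableType d) (R : realType)
    (mu : {measure set T -> \bar R}) (K : set T) (x D F : T -> R) n
    (y : 'I_n -> T -> R) m :
  mu setT = 1%E -> measurable K -> mu (~` K) = 0%E ->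
  bounded_on K x -> bounded_on K D -> bounded_on K F ->
  (forall i, bounded_on K (y i)) -> (forall i, rotates mu x (y i) D) ->
  (forall g, K g -> \sum_i y i g ^+ 2 = F g) ->
  ((m%:R + 1) * \int[mu]_g (x g ^+ m * F g * D g) =
   n%:R * \int[mu]_g (x g ^+ m.+2 * D g))%R.
Proof.
move=> mu1 mK muK bx bD bF bY xyD yF.
have bf i : bounded_on K (fun g => x g ^+ m * y i g ^+ 2 * D g).
  by do ![apply: bounded_onM|apply: bounded_onX].
have -> : (\int[mu]_g (x g ^+ m * F g * D g) =
    \int[mu]_g (\sum_i x g ^+ m * y i g ^+ 2 * D g))%R.
  apply: (as_eq_Rintegral mK muK); last by move=> g Kg; rewrite -mulr_suml -mulr_sumr yF.
    by do ![apply: bounded_onM|apply: bounded_onX].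
  exact: bounded_on_sum.
rewrite (as_Rintegral_sum mu1 mK muK bf) mulr_sumr.
under eq_bigr do rewrite (rotates_moment mu1 mK muK bx (bY _) bD (xyD _)).
by rewrite sumr_const card_ord mulr_natl.
Qed.

(** * Haar measures on USp(4) and SU(2) x SU(2) *)

Section haar_measurability.
Variable R : realType.
Local Notation C := (complex R).
Local Notation L i := (lshift 2 (i : 'I_2)).
Local Notation D i := (rshift 2 (i : 'I_2)).

Lemma measurable_Re_entry i j :
  measurable_fun setT (fun g : MX4 R => complex.Re (g i j)).
Proof.
move=> _ B mB; rewrite setTI; apply: sub_sigma_algebra.
by exists i, j, B; split=> //; left.
Qed.

Lemma measurable_Im_entry i j :
  measurable_fun setT (fun g : MX4 R => complex.Im (g i j)).
Proof.
move=> _ B mB; rewrite setTI; apply: sub_sigma_algebra.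
by exists i, j, B; split=> //; right.
Qed.

Definition cmeasurable (f : MX4 R -> C) : Prop :=
  measurable_fun setT (fun g => complex.Re (f g)) /\
  measurable_fun setT (fun g => complex.Im (f g)).

Lemma cmeasurable_entry i j : cmeasurable (fun g => g i j).
Proof. by split; [exact: measurable_Re_entry|exact: measurable_Im_entry]. Qed.

Lemma cmeasurable_cst c : cmeasurable (fun=> c).
Proof. by split; exact: measurable_cst. Qed.

Lemma cmeasurableD f h : cmeasurable f -> cmeasurable h ->
  cmeasurable (fun g => f g + h g).
Proof.
move=> [f1 f2] [h1 h2]; split.
  rewrite (_ : (fun g => _) = (fun g => complex.Re (f g)) \+
    (fun g => complex.Re (h g))); first exact: measurable_funD.
  by apply/funext => g /=; case: (f g) (h g) => [? ?] [? ?].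
rewrite (_ : (fun g => _) = (fun g => complex.Im (f g)) \+
  (fun g => complex.Im (h g))); first exact: measurable_funD.
by apply/funext => g /=; case: (f g) (h g) => [? ?] [? ?].
Qed.

Lemma cmeasurableM f h : cmeasurable f -> cmeasurable h ->
  cmeasurable (fun g => f g * h g).
Proof.
move=> [f1 f2] [h1 h2]; split.
  rewrite (_ : (fun g => _) =
    ((fun g => complex.Re (f g)) \* (fun g => complex.Re (h g))) \-
    ((fun g => complex.Im (f g)) \* (fun g => complex.Im (h g)))).
    by apply: measurable_funB; exact: measurable_funM.
  by apply/funext => g /=; case: (f g) (h g) => [? ?] [? ?].
rewrite (_ : (fun g => _) =
  ((fun g => complex.Re (f g)) \* (fun g => complex.Im (h g))) \+
  ((fun g => complex.Im (f g)) \* (fun g => complex.Re (h g)))).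
  by apply: measurable_funD; exact: measurable_funM.
by apply/funext => g /=; case: (f g) (h g) => [? ?] [? ?].
Qed.

Lemma cmeasurable_conj f : cmeasurable f -> cmeasurable (fun g => conjc (f g)).
Proof.
move=> [f1 f2]; split.
  rewrite (_ : (fun g => _) = (fun g => complex.Re (f g)))//.
  by apply/funext => g /=; case: (f g).
rewrite (_ : (fun g => _) = \- (fun g => complex.Im (f g))).
  exact: measurable_funN.
by apply/funext => g /=; case: (f g).
Qed.

Lemma cmeasurable_sum (I : Type) (s : seq I) (F : I -> MX4 R -> C) :
  (forall i, cmeasurable (F i)) -> cmeasurable (fun g => \sum_(i <- s) F i g).
Proof.
move=> mF; elim: s => [|i s IHs].
  by under eq_fun do rewrite big_nil; exact: cmeasurable_cst.
by under eq_fun do rewrite big_cons; exact: cmeasurableD.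
Qed.

Lemma cmeasurable_eq f c : cmeasurable f ->
  measurable [set g : MX4 R | f g = c].
Proof.
move=> [f1 f2].
rewrite (_ : mkset _ =
  ((fun g => complex.Re (f g)) @^-1` [set complex.Re c]) `&`
  ((fun g => complex.Im (f g)) @^-1` [set complex.Im c])).
  apply: measurableI; first by rewrite -[X in measurable X]setTI; exact: f1.
  by rewrite -[X in measurable X]setTI; exact: f2.
by apply/seteqP; split=> g /=; case: (f g) c => [? ?] [? ?] => -[/= -> ->].
Qed.

Definition mxmeasurable m n (F : MX4 R -> 'M[C]_(m, n)) : Prop :=
  forall i j, cmeasurable (fun g => F g i j).

Lemma mxmeasurable_eq m n (F : MX4 R -> 'M[C]_(m, n)) A : mxmeasurable F ->
  measurable [set g : MX4 R | F g = A].
Proof.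
move=> mF; rewrite (_ : mkset _ =
  \bigcap_(i in [set: 'I_m]) \bigcap_(j in [set: 'I_n])
    [set g | F g i j = A i j]).
  apply: fin_bigcap_measurable => // i _; apply: fin_bigcap_measurable => // j _.
  exact: cmeasurable_eq.
apply/seteqP; split=> [g /= <- i _ j _ //|g h]; apply/matrixP => i j.
exact: (h i I j I).
Qed.

Lemma mxmeasurable_id : mxmeasurable (fun g => g).
Proof. by move=> i j; exact: cmeasurable_entry. Qed.

Lemma mxmeasurable_cst m n (A : 'M[C]_(m, n)) : mxmeasurable (fun=> A).
Proof. by move=> i j; exact: cmeasurable_cst. Qed.

Lemma mxmeasurableM m n p (F : MX4 R -> 'M[C]_(m, n)) (G : MX4 R -> 'M[C]_(n, p)) :
  mxmeasurable F -> mxmeasurable G -> mxmeasurable (fun g => F g *m G g).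
Proof.
move=> mF mG i j; under eq_fun do rewrite mxE.
by apply: cmeasurable_sum => l; exact: cmeasurableM.
Qed.

Lemma mxmeasurable_tr m n (F : MX4 R -> 'M[C]_(m, n)) :
  mxmeasurable F -> mxmeasurable (fun g => (F g)^T).
Proof. by move=> mF i j; under eq_fun do rewrite mxE; exact: mF. Qed.

Lemma mxmeasurable_adj n (F : MX4 R -> 'M[C]_n) :
  mxmeasurable F -> mxmeasurable (fun g => adjmx (F g)).
Proof.
by move=> mF i j; under eq_fun do rewrite mxE; exact: cmeasurable_conj.
Qed.

Lemma measurable_unitary n (F : MX4 R -> 'M[C]_n) :
  mxmeasurable F -> measurable [set g : MX4 R | unitary (F g)].
Proof.
move=> mF; apply: mxmeasurable_eq; apply: mxmeasurableM => //.
exact: mxmeasurable_adj.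
Qed.

Lemma measurable_USp4 : measurable (@USp4 R : set (MX4 R)).
Proof.
rewrite (_ : @USp4 R = [set g : MX4 R | unitary g] `&`
  [set g : MX4 R | g^T *m J4 R *m g = J4 R])//.
apply: measurableI; first by apply: measurable_unitary; exact: mxmeasurable_id.
apply: mxmeasurable_eq; apply: mxmeasurableM; last exact: mxmeasurable_id.
apply: mxmeasurableM; last exact: mxmeasurable_cst.
by apply: mxmeasurable_tr; exact: mxmeasurable_id.
Qed.

Lemma measurable_SU2 (F : MX4 R -> 'M[C]_2) :
  mxmeasurable F -> measurable [set g : MX4 R | SU2 (F g)].
Proof.
move=> mF; rewrite (_ : mkset _ = [set g : MX4 R | unitary (F g)] `&`
  [set g : MX4 R | \det (F g) = 1])//.
apply: measurableI; first exact: measurable_unitary.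
apply: cmeasurable_eq; under eq_fun do rewrite det2 -mulN1r.
by apply: cmeasurableD;
  [exact: cmeasurableM|apply: cmeasurableM; [exact: cmeasurable_cst|exact: cmeasurableM]].
Qed.

(** The existential over the blocks is an uncountable union; reading the blocks off g replaces it by
    conditions on entries. *)
Lemma measurable_Hsub : measurable (@Hsub R : set (MX4 R)).
Proof.
pose bl (f h : 'I_2 -> 'I_(2 + 2)) (g : MX4 R) : 'M[C]_2 :=
  \matrix_(i, j) (g : 'M[C]_(2 + 2)) (f i) (h j).
have mbl f h : mxmeasurable (bl f h).
  by move=> i j; under eq_fun do rewrite mxE; exact: cmeasurable_entry.
pose l := @lshift 2 2; pose r := @rshift 2 2.
rewrite (_ : @Hsub R = ([set g : MX4 R | SU2 (bl l l g)] `&`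
  [set g | bl l r g = 0]) `&` ([set g | bl r l g = 0] `&` [set g | SU2 (bl r r g)])).
  by apply: measurableI; apply: measurableI;
    do ?[exact: measurable_SU2|exact: mxmeasurable_eq].
have blE (g : 'M[C]_(2 + 2)) :
    g = block_mx (bl l l g) (bl l r g) (bl r l g) (bl r r g).
  rewrite -[LHS]submxK; congr block_mx; apply/matrixP => i j; rewrite !mxE //.
apply/seteqP; split=> [g [a [b [sa [sb gab]]]]|g /= [[h1 h2] [h3 h4]]].
  have := blE g; rewrite {1}gab => /(@eq_block_mx _ 2 2 2 2)[h1 h2 h3 h4] /=.
  by rewrite -h1 -h2 -h3 -h4.
exists (bl l l g), (bl r r g); split => //; split => //.
by rewrite {1}(blE g) h2 h3.
Qed.

Lemma measurable_mulmx (k : 'M[C]_4) :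
  measurable_fun setT (fun g : MX4 R => k *m g : MX4 R).
Proof.
have hE : @measurable _ (MX4 R) = <<s @mx_gen R >> by [].
have [hRe hIm] : (forall i j, measurable_fun setT
    (fun g : MX4 R => complex.Re ((k *m g) i j))) /\
  (forall i j, measurable_fun setT (fun g : MX4 R => complex.Im ((k *m g) i j))).
  by split=> i j; have [] := mxmeasurableM (mxmeasurable_cst k) mxmeasurable_id i j.
apply: (measurability _ hE) => // _ [_ [i [j [B [mB [|]]]]] ->] <-.
  exact: hRe.
exact: hIm.
Qed.

Lemma haar_prob_preserves (K : set 'M[C]_4) (mu : {measure set (MX4 R) -> \bar R}) k :
  haar_prob K mu -> K k -> preserves mu (fun g : MX4 R => k *m g : MX4 R).
Proof.
by move=> [_ [_ inv]] Kk; split; [exact: measurable_mulmx|exact: inv].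
Qed.

End haar_measurability.

(** * Mixed moments of the two diagonal traces *)

Section haar_moments.
Variable R : realType.
Local Notation C := (complex R).
Local Notation L i := (lshift 2 (i : 'I_2)).
Local Notation D i := (rshift 2 (i : 'I_2)).

Lemma mul_block_lshift (A B A' B' : 'M[C]_2) (g : 'M[C]_(2 + 2)) i j :
  (block_mx A B A' B' *m g) (L i) j =
  A i 0 * g (L 0) j + A i 1 * g (L 1) j + (B i 0 * g (D 0) j + B i 1 * g (D 1) j).
Proof.
by rewrite mxE big_split_ord /= !sum2 !block_mxEul !block_mxEur.
Qed.

Lemma mul_block_rshift (A B A' B' : 'M[C]_2) (g : 'M[C]_(2 + 2)) i j :
  (block_mx A B A' B' *m g) (D i) j =
  A' i 0 * g (L 0) j + A' i 1 * g (L 1) j +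
  (B' i 0 * g (D 0) j + B' i 1 * g (D 1) j).
Proof.
by rewrite mxE big_split_ord /= !sum2 !block_mxEdl !block_mxEdr.
Qed.

(** On USp(4), [trul] and [trdr] are the traces of the diagonal blocks and [nrmul] is |a|^2. Each is
    written with entries of a single column, where left translations are easy to follow. *)
Definition trul (g : MX4 R) : R := 2 * complex.Re (g (L 0) (L 0)).
Definition trdr (g : MX4 R) : R := 2 * complex.Re (g (D 0) (D 0)).
Definition nrmul (g : MX4 R) : R := normsq (g (L 0) (L 0)) + normsq (g (L 1) (L 0)).

Lemma USp4_coords (g : MX4 R) : USp4 g ->
  [/\ normsq (g (D 0) (D 0)) + normsq (g (D 1) (D 0)) = nrmul g,
   nrmul g + (normsq (g (D 0) (L 0)) + normsq (g (D 1) (L 0))) = 1 &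
   complex.Re (\tr g) = trul g + trdr g].
Proof.
move=> /USp4_blocks[a [b [c [d [e [f [h [k [-> e1 e2]]]]]]]]].
rewrite /nrmul /trul /trdr.
rewrite !(@block_mxEul _ 2 2 2 2) !(@block_mxEdl _ 2 2 2 2) !(@block_mxEdr _ 2 2 2 2).
rewrite !quat00 !quat10.
split=> //.
rewrite (@mxtrace_block _ 2 2) /mxtrace !sum2 !quat00 !mxE /=.
by case: a h {e1 e2} => [? ?] [? ?] /=; ring.
Qed.

Variable K : set (MX4 R).
Variable mu : {measure set (MX4 R) -> \bar R}.
Hypothesis mK : measurable K.
Hypothesis hmu : haar_prob K mu.
Hypothesis KU : K `<=` @USp4 R.
Hypothesis HK : @Hsub R `<=` K.

Let mu1 : mu setT = 1%E. Proof. by case: hmu. Qed.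
Let muK : mu (~` K) = 0%E. Proof. by case: hmu => _ []. Qed.

Local Notation bounded_on := (bounded_on K).
Local Notation E f := (\int[mu]_x (f x))%R.

Lemma le1_normr (x y : R) : 0 <= y -> x ^+ 2 + y <= 1 -> `|x| <= 1.
Proof.
move=> y0 xy; rewrite -(@ler_pXn2r _ 2) ?nnegrE// expr1n real_normK ?num_real//.
by apply: le_trans xy; rewrite lerDl.
Qed.

Lemma normsq_ge0 (z : C) : 0 <= normsq z.
Proof. by rewrite addr_ge0 ?sqr_ge0. Qed.

Lemma entry_bounded i j : (forall g, K g -> normsq (g i j) <= 1) ->
  bounded_on (fun g : MX4 R => complex.Re (g i j)) /\
  bounded_on (fun g : MX4 R => complex.Im (g i j)).
Proof.
move=> b1; split; split.
- exact: measurable_Re_entry.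
- exists 1 => g /b1; apply: le1_normr; exact: sqr_ge0.
- exact: measurable_Im_entry.
- exists 1 => g /b1; rewrite /normsq addrC; apply: le1_normr; exact: sqr_ge0.
Qed.

Lemma column_bounded g : K g ->
  [/\ normsq (g (L 0) (L 0)) <= 1, normsq (g (L 1) (L 0)) <= 1,
      normsq (g (D 0) (L 0)) <= 1 & normsq (g (D 1) (L 0)) <= 1] /\
  (normsq (g (D 0) (D 0)) <= 1 /\ normsq (g (D 1) (D 0)) <= 1).
Proof.
move=> /KU /USp4_coords[]; rewrite /nrmul.
have := normsq_ge0 (g (L 0) (L 0)); have := normsq_ge0 (g (L 1) (L 0)).
have := normsq_ge0 (g (D 0) (L 0)); have := normsq_ge0 (g (D 1) (L 0)).
have := normsq_ge0 (g (D 0) (D 0)); have := normsq_ge0 (g (D 1) (D 0)).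
by do ?split; lra.
Qed.

Let bL0 := @entry_bounded (L 0) (L 0)
  (fun g Kg => let: conj (And4 h _ _ _) _ := column_bounded Kg in h).
Let bL1 := @entry_bounded (L 1) (L 0)
  (fun g Kg => let: conj (And4 _ h _ _) _ := column_bounded Kg in h).
Let bD0 := @entry_bounded (D 0) (L 0)
  (fun g Kg => let: conj (And4 _ _ h _) _ := column_bounded Kg in h).
Let bD1 := @entry_bounded (D 1) (L 0)
  (fun g Kg => let: conj (And4 _ _ _ h) _ := column_bounded Kg in h).
Let bDD0 := @entry_bounded (D 0) (D 0)
  (fun g Kg => let: conj _ (conj h _) := column_bounded Kg in h).
Let bDD1 := @entry_bounded (D 1) (D 0)
  (fun g Kg => let: conj _ (conj _ h) := column_bounded Kg in h).

Let bZ (c : R) (f : MX4 R -> R) : bounded_on f -> bounded_on (fun g => c * f g).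
Proof. by move=> bf; apply: bounded_onM => //; exact: bounded_on_cst. Qed.

Lemma bounded_trul : bounded_on trul.
Proof. exact: bZ bL0.1. Qed.

Lemma bounded_trdr : bounded_on trdr.
Proof. exact: bZ bDD0.1. Qed.

Lemma bounded_nrmul : bounded_on nrmul.
Proof.
by apply: bounded_onD; apply: bounded_onD; apply: bounded_onX;
  [exact: bL0.1|exact: bL0.2|exact: bL1.1|exact: bL1.2].
Qed.

(** The coefficient of s in the trace of the upper left block after left multiplication by c + s q,
    where q is the imaginary quaternion with coordinates (u, v, w). *)
Definition yul (u v w : R) (g : MX4 R) : R :=
  -2 * (u * complex.Im (g (L 0) (L 0)) +
        (v * complex.Re (g (L 1) (L 0)) + w * complex.Im (g (L 1) (L 0)))).

Definition ydr (u v w : R) (g : MX4 R) : R :=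
  -2 * (u * complex.Im (g (D 0) (D 0)) +
        (v * complex.Re (g (D 1) (D 0)) + w * complex.Im (g (D 1) (D 0)))).

Lemma bounded_yul u v w : bounded_on (yul u v w).
Proof.
by apply: bZ; apply: bounded_onD; [exact: bZ bL0.2|];
  apply: bounded_onD; [exact: bZ bL1.1|exact: bZ bL1.2].
Qed.

Lemma bounded_ydr u v w : bounded_on (ydr u v w).
Proof.
by apply: bZ; apply: bounded_onD; [exact: bZ bDD0.2|];
  apply: bounded_onD; [exact: bZ bDD1.1|exact: bZ bDD1.2].
Qed.

Definition unitq (c s u v w : R) : 'M[C]_2 :=
  quat (Complex c (s * u)) (Complex (s * v) (s * w)).

Lemma unitq_SU2 c s u v w : c ^+ 2 + s ^+ 2 = 1 -> u ^+ 2 + v ^+ 2 + w ^+ 2 = 1 ->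
  SU2 (unitq c s u v w).
Proof.
move=> cs uvw; apply: quat_SU2; rewrite /normsq /= -cs -[s ^+ 2]mulr1 -uvw.
ring.
Qed.

Lemma SU2_1 : SU2 (1%:M : 'M[C]_2).
Proof.
rewrite -(quat1 1); apply: quat_SU2; rewrite /normsq /=; ring.
Qed.

(** Translation by diag(q, 1) leaves the lower half of the third column alone and preserves the norm
    of the upper half of the first; so any weight in [trdr] and [nrmul] is invariant. *)
Lemma rotates_trul u v w q j : u ^+ 2 + v ^+ 2 + w ^+ 2 = 1 ->
  rotates mu trul (yul u v w) (fun g => trdr g ^+ q * nrmul g ^+ j).
Proof.
move=> uvw c s cs; pose k : 'M[C]_(2 + 2) := block_mx (unitq c s u v w) 0 0 1%:M.
exists (fun g : MX4 R => k *m g : MX4 R).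
  apply: haar_prob_preserves hmu _; apply: HK.
  by exists (unitq c s u v w), 1%:M; split; [exact: unitq_SU2|split=> //; exact: SU2_1].
move=> g; rewrite /trul /trdr /nrmul /yul /k.
rewrite !mul_block_lshift !mul_block_rshift /unitq !mxE /= !(mul0r, mul1r, addr0, add0r).
rewrite /normsq.
case: (g (L 0) (L 0)) (g (L 1) (L 0)) => [x1 x2] [x3 x4] /=.
split; first by ring.
congr (_ * _ ^+ _); transitivity ((c ^+ 2 + s ^+ 2 * (u ^+ 2 + v ^+ 2 + w ^+ 2)) *
  (x1 ^+ 2 + x2 ^+ 2 + (x3 ^+ 2 + x4 ^+ 2))); first by ring.
by rewrite uvw mulr1 cs mul1r.
Qed.

Lemma rotates_trdr u v w p j : u ^+ 2 + v ^+ 2 + w ^+ 2 = 1 ->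
  rotates mu trdr (ydr u v w) (fun g => trul g ^+ p * nrmul g ^+ j).
Proof.
move=> uvw c s cs; pose k : 'M[C]_(2 + 2) := block_mx 1%:M 0 0 (unitq c s u v w).
exists (fun g : MX4 R => k *m g : MX4 R).
  apply: haar_prob_preserves hmu _; apply: HK.
  by exists 1%:M, (unitq c s u v w); split; [exact: SU2_1|split=> //; exact: unitq_SU2].
move=> g; rewrite /trul /trdr /nrmul /ydr /k.
rewrite !mul_block_lshift !mul_block_rshift /unitq !mxE /= !(mul0r, mul1r, addr0, add0r).
split=> //.
by case: (g (D 0) (D 0)) (g (D 1) (D 0)) => [x1 x2] [x3 x4] /=; ring.
Qed.

Definition mom p q j := E (fun g => trul g ^+ p * (trdr g ^+ q * nrmul g ^+ j)).

Lemma bounded_mom p q j :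
  bounded_on (fun g => trul g ^+ p * (trdr g ^+ q * nrmul g ^+ j)).
Proof.
apply: bounded_onM; [apply: bounded_onX; exact: bounded_trul|].
by apply: bounded_onM; apply: bounded_onX; [exact: bounded_trdr|exact: bounded_nrmul].
Qed.

Lemma mom_drE p q j :
  mom p q j = E (fun g => trdr g ^+ q * (trul g ^+ p * nrmul g ^+ j)).
Proof. by apply: eq_Rintegral => g _; rewrite mulrCA. Qed.

Lemma bounded_weight (f : MX4 R -> R) q j : bounded_on f ->
  bounded_on (fun g => f g ^+ q * nrmul g ^+ j).
Proof.
by move=> bf; apply: bounded_onM; apply: bounded_onX => //; exact: bounded_nrmul.
Qed.

Definition axis (k : nat) (i : 'I_3) : R := ((i : nat) == k)%:R.

Lemma axisE (i : 'I_3) : axis 0 i ^+ 2 + axis 1 i ^+ 2 + axis 2 i ^+ 2 = 1.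
Proof. by case: i => [[|[|[|//]]] lt]; rewrite /axis /=; ring. Qed.

Lemma mom_ul1 q j : mom 1 q j = 0.
Proof.
rewrite -[RHS](rotates_moment1 mu1 mK muK bounded_trul (bounded_yul _ _ _)
  (bounded_weight q j bounded_trdr) (rotates_trul _ _ (axisE 0))).
by apply: eq_Rintegral => g _; rewrite expr1.
Qed.

Lemma mom_dr1 p j : mom p 1 j = 0.
Proof.
rewrite mom_drE -[RHS](rotates_moment1 mu1 mK muK bounded_trdr (bounded_ydr _ _ _)
  (bounded_weight p j bounded_trul) (rotates_trdr _ _ (axisE 0))).
by apply: eq_Rintegral => g _; rewrite expr1.
Qed.

Let bF (f : MX4 R -> R) : bounded_on f -> bounded_on (fun g => 4 * nrmul g - f g ^+ 2).
Proof.
move=> bf; apply: bounded_onD; first exact: bZ bounded_nrmul.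
by apply: bounded_onN; apply: bounded_onX.
Qed.

(** The first quaternion, doubled, lies on a 3-sphere of radius 2|a|: the three imaginary directions
    have sum of squares 4|a|^2 - x^2, and p + 4 is (p + 1) + 3. *)
Lemma mom_ul p q j :
  (p%:R + 4) * mom p.+2 q j = 4 * (p%:R + 1) * mom p q j.+1.
Proof.
have := rotates_family p mu1 mK muK bounded_trul (bounded_weight q j bounded_trdr)
  (bF bounded_trul) (fun i : 'I_3 => bounded_yul _ _ _)
  (fun i => rotates_trul q j (axisE i)).
have sumE g : K g ->
    \sum_i yul (axis 0 i) (axis 1 i) (axis 2 i) g ^+ 2 = 4 * nrmul g - trul g ^+ 2.
  move=> Kg; rewrite !big_ord_recl big_ord0 /axis /yul /nrmul /normsq /trul /=.
  ring.
move=> /(_ sumE).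
have -> : E (fun g => trul g ^+ p * (4 * nrmul g - trul g ^+ 2) *
    (trdr g ^+ q * nrmul g ^+ j)) = 4 * mom p q j.+1 - mom p.+2 q j.
  rewrite -(as_RintegralZl mu1 mK muK); last exact: bounded_mom.
  rewrite -(as_RintegralB mu1 mK muK); [|exact: bZ (bounded_mom _ _ _)|exact: bounded_mom].
  by apply: eq_Rintegral => g _; rewrite !exprS; ring.
rewrite -/(mom p.+2 q j); lra.
Qed.

(** The sphere of the lower right quaternion has radius 2|d|; the equality |d| = |a| on [K] brings
    back the same weight [nrmul]. *)
Lemma mom_dr p q j :
  (q%:R + 4) * mom p q.+2 j = 4 * (q%:R + 1) * mom p q j.+1.
Proof.
have := rotates_family q mu1 mK muK bounded_trdr (bounded_weight p j bounded_trul)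
  (bF bounded_trdr) (fun i : 'I_3 => bounded_ydr _ _ _)
  (fun i => rotates_trdr p j (axisE i)).
have sumE g : K g ->
    \sum_i ydr (axis 0 i) (axis 1 i) (axis 2 i) g ^+ 2 = 4 * nrmul g - trdr g ^+ 2.
  move=> /KU /USp4_coords[<- _ _].
  rewrite !big_ord_recl big_ord0 /axis /ydr /normsq /trdr /=; ring.
move=> /(_ sumE).
have -> : E (fun g => trdr g ^+ q * (4 * nrmul g - trdr g ^+ 2) *
    (trul g ^+ p * nrmul g ^+ j)) = 4 * mom p q j.+1 - mom p q.+2 j.
  rewrite -(as_RintegralZl mu1 mK muK); last exact: bounded_mom.
  rewrite -(as_RintegralB mu1 mK muK); [|exact: bZ (bounded_mom _ _ _)|exact: bounded_mom].
  by apply: eq_Rintegral => g _; rewrite !exprS; ring.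
rewrite -mom_drE; lra.
Qed.

Definition ycol (u1 u2 u3 u4 : R) (g : MX4 R) : R :=
  -2 * (u1 * complex.Re (g (D 0) (L 0)) + (u2 * complex.Im (g (D 0) (L 0)) +
     (u3 * complex.Re (g (D 1) (L 0)) + u4 * complex.Im (g (D 1) (L 0))))).

Lemma bounded_ycol u1 u2 u3 u4 : bounded_on (ycol u1 u2 u3 u4).
Proof.
apply: bZ; apply: bounded_onD; first exact: bZ bD0.1.
apply: bounded_onD; first exact: bZ bD0.2.
by apply: bounded_onD; [exact: bZ bD1.1|exact: bZ bD1.2].
Qed.

(** The weight is the constant 1: a rotation mixing the two halves changes both |a| and the lower
    right trace. It lies in USp(4) but not in the block-diagonal subgroup, whence the hypothesis on
    [K]. *)
Lemma rotates_ycol u1 u2 u3 u4 : K = @USp4 R ->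
  u1 ^+ 2 + u2 ^+ 2 + u3 ^+ 2 + u4 ^+ 2 = 1 ->
  rotates mu trul (ycol u1 u2 u3 u4) (fun=> 1).
Proof.
move=> KE u c s cs.
pose k := rotmx c (Complex (s * u1) (s * u2)) (Complex (s * u3) (s * u4)).
exists (fun g : MX4 R => k *m g : MX4 R).
  apply: haar_prob_preserves hmu _; rewrite KE; apply: rotmx_USp4.
  by rewrite /normsq /= -cs -[s ^+ 2]mulr1 -u; ring.
move=> g; split=> //; rewrite /trul /ycol /k /rotmx adj_quat.
rewrite mul_block_lshift !mxE /=.
case: (g (L 0) (L 0)) (g (L 1) (L 0)) (g (D 0) (L 0)) (g (D 1) (L 0)).
move=> x1 x2 [x3 x4] [x5 x6] [x7 x8] /=; ring.
Qed.

Definition axis7 (k : nat) (i : 'I_7) : R := ((i : nat) == k)%:R.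

Lemma mom_col p : K = @USp4 R ->
  (p%:R + 8) * mom p.+2 0 0 = 4 * (p%:R + 1) * mom p 0 0.
Proof.
move=> KE.
(* Three imaginary directions inside the upper block and four in the lower one; with [trul] they are
   the eight real coordinates of a column on the sphere of radius 2. *)
pose y (i : 'I_7) := if (i < 3)%N then yul (axis7 0 i) (axis7 1 i) (axis7 2 i)
  else ycol (axis7 3 i) (axis7 4 i) (axis7 5 i) (axis7 6 i).
have byi i : bounded_on (y i).
  by rewrite /y; case: ifP => _; [exact: bounded_yul|exact: bounded_ycol].
have rot i : rotates mu trul (y i) (fun=> 1).
  rewrite /y; case: ifPn => i3.
    have := @rotates_trul (axis7 0 i) (axis7 1 i) (axis7 2 i) 0 0.
    under eq_fun do rewrite !expr0 mulr1; apply.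
    by case: i i3 => [[|[|[|i]]] lt] //= _; rewrite /axis7 /=; ring.
  apply: rotates_ycol => //.
  by case: i i3 => [[|[|[|[|[|[|[|i]]]]]]] lt] //= _; rewrite /axis7 /=; ring.
have bT : bounded_on (fun g => 4 - trul g ^+ 2).
  apply: bounded_onD; first exact: bounded_on_cst.
  by apply: bounded_onN; apply: bounded_onX; exact: bounded_trul.
have sumE g : K g -> \sum_i y i g ^+ 2 = 4 - trul g ^+ 2.
  move=> /KU /USp4_coords[_ e _]; have := congr1 ( *%R 4) e; rewrite mulr1 => <-.
  rewrite !big_ord_recl big_ord0 /y /= /axis7 /yul /ycol /nrmul /normsq /trul /=.
  by ring.
have := rotates_family p mu1 mK muK bounded_trul (bounded_on_cst _ 1) bT byi rot sumE.
have -> : E (fun g => trul g ^+ p * (4 - trul g ^+ 2) * 1) =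
    4 * mom p 0 0 - mom p.+2 0 0.
  rewrite -(as_RintegralZl mu1 mK muK); last exact: bounded_mom.
  rewrite -(as_RintegralB mu1 mK muK); [|exact: bZ (bounded_mom _ _ _)|exact: bounded_mom].
  by apply: eq_Rintegral => g _; rewrite !exprS !expr0; ring.
have -> : E (fun g => trul g ^+ p.+2 * 1) = mom p.+2 0 0.
  by apply: eq_Rintegral => g _; rewrite !expr0 !mulr1.
lra.
Qed.

Variable c : nat -> R.
Hypothesis c0 : c 0%N = 1.
Hypothesis c1 : c 1%N = 0.
Hypothesis cS : forall p, (p%:R + 4) * c p.+2 = 4 * (p%:R + 1) * c p.

Let nat_neq0 (p k : nat) : p%:R + k.+1%:R != 0 :> R.
Proof. by rewrite -natrD pnatr_eq0 addnS. Qed.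

(** Raising p or q by two multiplies by the ratio of [c] and trades the square for one factor |a|^2.
    The induction carries p and p + 1 together; for odd exponents both sides vanish, so the rounded
    halves are harmless. *)
Lemma mom_factor p q j : mom p q j = c p * c q * mom 0 0 (j + p./2 + q./2).
Proof.
have base k i : mom 0 k i = c k * mom 0 0 (i + k./2).
  suff : forall i, mom 0 k i = c k * mom 0 0 (i + k./2) /\
      mom 0 k.+1 i = c k.+1 * mom 0 0 (i + k.+1./2) by move=> /(_ i)[].
  elim: k {i} => [|k IHk] i; first by rewrite c0 c1 addn0 mul1r mul0r mom_dr1.
  split; first exact: (IHk i).2.
  apply: (mulfI (nat_neq0 k 3)); rewrite mom_dr (IHk i.+1).1 [RHS]mulrA cS /=.
  by rewrite addSnnS; ring.
suff : forall j, mom p q j = c p * c q * mom 0 0 (j + p./2 + q./2) /\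
    mom p.+1 q j = c p.+1 * c q * mom 0 0 (j + p.+1./2 + q./2) by move=> /(_ j)[].
elim: p {j} => [|p IHp] j.
  by rewrite base mom_ul1 c0 c1 addn0 !mul0r mul1r.
split; first exact: (IHp j).2.
apply: (mulfI (nat_neq0 p 3)); rewrite mom_ul (IHp j.+1).1 -!mulrA [RHS]mulrA cS /=.
by rewrite addSnnS; ring.
Qed.

Lemma odd_moment0 p : odd p -> c p = 0.
Proof.
elim/ltn_ind: p => [[|[|p]]] // IHp; rewrite /= negbK => op.
by apply: (mulfI (nat_neq0 p 3)); rewrite cS IHp// !mulr0.
Qed.

Lemma bounded_trace : bounded_on (fun g => trul g + trdr g).
Proof. by apply: bounded_onD; [exact: bounded_trul|exact: bounded_trdr]. Qed.

(** In the binomial expansion the terms with p odd vanish, and for p even the halves of p and n - p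
    add up to the half of n: the same moment of |a|^2 factors out of every term. *)
Lemma trace_moment n :
  E (fun g => (trul g + trdr g) ^+ n) = mom 0 0 n./2 * mixmom c n 0 0.
Proof.
have bm (p : 'I_n.+1) : bounded_on (fun g =>
    'C(n, p)%:R * (trul g ^+ p * (trdr g ^+ (n - p) * nrmul g ^+ 0))).
  exact: bZ (bounded_mom _ _ _).
transitivity (E (fun g => \sum_(p < n.+1)
    'C(n, p)%:R * (trul g ^+ p * (trdr g ^+ (n - p) * nrmul g ^+ 0)))).
  apply: eq_Rintegral => g _; rewrite addrC exprDn; apply: eq_bigr => p _.
  by rewrite expr0 mulr1 -[LHS]mulr_natl [trdr _ ^+ _ * _]mulrC.
rewrite (as_Rintegral_sum mu1 mK muK bm) mulr_sumr; apply: eq_bigr => p _.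
rewrite (as_RintegralZl mu1 mK muK _ (bounded_mom _ _ _)) -/(mom p (n - p) 0).
rewrite mom_factor addn0 add0n addn0.
have pn : (p <= n)%N by rewrite -ltnS.
have [op|ep] := boolP (odd p); first by rewrite odd_moment0// !(mul0r, mulr0).
have -> : (p./2 + (n - p)./2)%N = n./2.
  by rewrite -[in RHS](subnKC pn) halfD (negbTE ep) add0n.
by ring.
Qed.

(** The lower left block is zero here, so |a| = 1. *)
Lemma nrm_moment_Hsub j : K = @Hsub R -> mom 0 0 j = 1.
Proof.
move=> KE; rewrite -[RHS](prob_Rintegral_cst mu1 1).
apply: (as_eq_Rintegral mK muK) => [||g Kg]; [exact: bounded_mom|exact: bounded_on_cst|].
rewrite !expr0 !mul1r.
have /USp4_coords[_ e _] := KU Kg.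
suff -> : nrmul g = 1 by rewrite expr1n.
move: Kg e; rewrite KE => -[a [b [_ [_ ->]]]].
by rewrite /nrmul !(@block_mxEdl _ 2 2 2 2) !mxE /normsq /= expr0n /= !addr0.
Qed.

Lemma even_moment_gt0 m : 0 < c m.*2.
Proof.
elim: m => [|m IHm]; first by rewrite c0.
rewrite doubleS -(pmulr_rgt0 _ (_ : 0 < m.*2%:R + 4)).
  by rewrite cS mulr_gt0// mulr_gt0// addr_gt0// -natr1.
by rewrite ltr_wpDl.
Qed.

(* [trul] has the law of a coordinate of the unit sphere S^7 rescaled by 2, and
   given [nrmul] that of a coordinate of a 3-sphere: comparing both moments
   yields those of [nrmul]. *)
Lemma nrm_moment_USp4 m : K = @USp4 R ->
  (m%:R + 2) * (m%:R + 3) * mom 0 0 m = 6.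
Proof.
move=> KE; elim: m => [|m IHm].
  suff -> : mom 0 0 0 = 1 by rewrite !add0r mulr1; ring.
  rewrite -[RHS](prob_Rintegral_cst mu1 1); apply: eq_Rintegral => g _.
  by rewrite !expr0 !mulr1.
have := mom_col m.*2 KE.
rewrite (mom_factor m.*2.+2) (mom_factor m.*2) c0 !mulr1 addn0 add0n /=.
rewrite doubleK !addn0 => h.
have cm : c m.*2 != 0 by rewrite gt_eqF// even_moment_gt0.
(* [mom_col] and [cS] both express [c (2m + 2)] through [c (2m)]; dividing them leaves the ratio (m
   + 2) / (m + 4) of consecutive moments of |a|^2. *)
have {}h : (2 * m%:R + 8) * mom 0 0 m.+1 = (2 * m%:R + 4) * mom 0 0 m.
  apply: (mulfI cm).
  have := cS m.*2; move: h; rewrite -muln2 natrM => h cSm.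
  have k0 : 4 * (m%:R * 2 + 1) != 0 :> R.
    by rewrite mulf_neq0// lt0r_neq0// ltr_wpDl// mulr_ge0.
  apply: (mulfI k0).
  transitivity ((m%:R * 2 + 4) * c (m * 2).+2 * ((2 * m%:R + 8) * mom 0 0 m.+1)).
    by rewrite cSm; ring.
  transitivity ((m%:R * 2 + 4) * ((m%:R * 2 + 8) * (c (m * 2).+2 * mom 0 0 m.+1))).
    by ring.
  by rewrite h add0n; ring.
have := congr1 ( *%R (m%:R + 3)) h; move: IHm; rewrite -natr1; lra.
Qed.

End haar_moments.

(** * Moments of the trace on each group *)

Section trace_moments.
Variables (R : realType) (mu : {measure set (MX4 R) -> \bar R}) (c : nat -> R).
Hypothesis c0 : c 0%N = 1.
Hypothesis c1 : c 1%N = 0.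
Hypothesis cS : forall p, (p%:R + 4) * c p.+2 = 4 * (p%:R + 1) * c p.

Lemma Hsub_USp4 : @Hsub R `<=` @USp4 R.
Proof. by move=> _ [a [b [sa [sb ->]]]]; exact: SU2_USp4. Qed.

Lemma Hsub_trace_moment n : haar_prob (@Hsub R) mu ->
  (\int[mu]_g ((trul g + trdr g) ^+ n))%R = mixmom c n 0 0.
Proof.
move=> h; rewrite (trace_moment (@measurable_Hsub R) h Hsub_USp4 _ c0 c1 cS)//.
by rewrite (nrm_moment_Hsub (@measurable_Hsub R) h Hsub_USp4)// mul1r.
Qed.

(** For n = 2 m the factor 24 / ((n + 4) (n + 6)) of [mixmom_weyl] equals 6 / ((m + 2) (m + 3)), the
    m-th moment of |a|^2. For odd n every term has an odd exponent and both sides vanish. *)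
Lemma USp4_trace_moment n : haar_prob (@USp4 R) mu ->
  (\int[mu]_g ((trul g + trdr g) ^+ n))%R = mixmom c n 2 0 - mixmom c n 1 1.
Proof.
move=> h; rewrite (trace_moment (@measurable_USp4 R) h _ Hsub_USp4 c0 c1 cS)//.
have n46 : (n%:R + 4) * (n%:R + 6) != 0 :> R.
  by rewrite mulf_neq0// -natrD pnatr_eq0 addnS.
apply: (mulfI n46); rewrite (mixmom_weyl c1 cS).
have [on|en] := boolP (odd n).
  suff -> : mixmom c n 0 0 = 0 by rewrite !mulr0.
  apply: big1 => p _; rewrite !addn0.
  have pn : (p <= n)%N by rewrite -ltnS.
  have [op|ep] := boolP (odd p).
    by rewrite (odd_moment0 c1 cS op) mul0r mulr0.
  by rewrite (odd_moment0 c1 cS (_ : odd (n - p))) ?mulr0// oddB// on (negbTE ep).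
have nE : n%:R = 2 * (n./2)%:R :> R.
  by rewrite -natrM mul2n even_halfK.
have := nrm_moment_USp4 (@measurable_USp4 R) h (@subset_refl _ _) Hsub_USp4
  c0 c1 cS n./2 erefl.
rewrite nE => e; transitivity (4 * (((n./2)%:R + 2) * ((n./2)%:R + 3) *
  mom mu 0 0 n./2) * mixmom c n 0 0); first by ring.
by rewrite e; ring.
Qed.

End trace_moments.

(** * The convolution densities *)

Section semicircle.
Variable R : realType.
Local Notation mu := (@lebesgue_measure R).

Local Notation seg := (`[(-2 : R)%R, (2 : R)%R]%classic).

(** [Num.sqrt] is zero on negative numbers, so this is already the extension by zero of the
    semicircle, continuous on the whole line. *)
Definition semi (x : R) : R := Num.sqrt (4 - x ^+ 2).

Lemma semi_ge0 x : 0 <= semi x. Proof. exact: sqrtr_ge0. Qed.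

Lemma sqr_semi x : -2 <= x <= 2 -> semi x ^+ 2 = 4 - x ^+ 2.
Proof. by move=> /andP[x1 x2]; rewrite sqr_sqrtr//; nra. Qed.

Lemma semi_out x : x \notin `[-2, 2] -> semi x = 0.
Proof.
rewrite in_itv /= negb_and -!ltNge => x2; apply/eqP; rewrite sqrtr_eq0.
by case/orP: x2 => x2; nra.
Qed.

Lemma continuous_poly2 : continuous (fun x : R => 4 - x ^+ 2).
Proof.
move=> x; apply: cvgB; first exact: cvg_cst.
exact: exprn_continuous.
Qed.

Lemma continuous_semi : continuous semi.
Proof.
move=> x; apply: (@continuous_comp _ _ _ (fun x : R => 4 - x ^+ 2) Num.sqrt).
  exact: continuous_poly2.
exact: sqrt_continuous.
Qed.

Lemma derivable_LRcontinuous (F : R -> R) a b :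
  (forall x : R, derivable F x 1) -> derivable_oo_LRcontinuous F a b.
Proof.
move=> dF; have cF x : F @ x --> F x.
  exact/differentiable_continuous/derivable1_diffP/dF.
by split=> [x _||]; [exact: dF|exact: cvg_at_right_filter|exact: cvg_at_left_filter].
Qed.

Lemma integral_semi_itv :
  (\int[mu]_(x in seg) (semi x)%:E = (2 * pi)%:E)%E.
Proof.
pose F := fun t : R => 2 * sin t.
have dF (t : R) : is_derive t (1 : R) F (2 * cos t).
  exact: (@is_deriveZ _ _ _ sin 2 t 1 (cos t)).
have F' : derive1 F = fun t => 2 * cos t.
  by apply/funext => t; rewrite derive1E; exact: derive_val.
have cF' : continuous (fun t : R => 2 * cos t).
  by move=> t; apply: cvgM; [exact: cvg_cst|exact: continuous_cos].
have FE : F (- (pi / 2)) = -2 /\ F (pi / 2) = 2.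
  by rewrite /F sinN sin_pihalf mulr1 mulrN1.
have pi2 : - (pi / 2) < pi / 2 :> R by have := pi_gt0 R; lra.
rewrite -[X in `[X, _]]FE.1 -[X in `[_, X]]FE.2.
rewrite integration_by_substitution_increasing ?F'; last first.
- exact/continuous_subspaceT/continuous_semi.
- by apply: derivable_LRcontinuous => x; exact: ex_derive.
- by apply/cvg_ex; exists (2 * cos (pi / 2)); apply: cvg_at_left_filter; exact: cF'.
- by apply/cvg_ex; exists (2 * cos (- (pi / 2))); apply: cvg_at_right_filter; exact: cF'.
- by move=> x _; exact: cF'.
- by move=> x y xI yI xy; rewrite /F ltr_pM2l// ltr_sin.
- exact: ltW.
(* After x = 2 sin t the integrand is 4 cos^2 t, with this antiderivative. *)
pose G := fun t : R => 2 * t + 2 * (sin t * cos t).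
have dG (t : R) : is_derive t (1 : R) G (4 * cos t ^+ 2).
  have h : is_derive t (1 : R) ((2 : R) \*: (id : R -> R) + (2 : R) \*: (sin * cos))
      (2 *: 1 + 2 *: (sin t *: - sin t + cos t *: cos t)).
    by apply: is_deriveD.
  apply: is_derive_eq h _; rewrite /GRing.scale /=.
  by have := cos2Dsin2 t; nra.
transitivity (\int[mu]_(x in `[(- (pi / 2))%R, (pi / 2)%R]) (4 * cos x ^+ 2)%:E)%E.
  apply: eq_integral => x; rewrite inE /= in_itv /= => xI; congr EFin.
  change (semi (2 * sin x) * (2 * cos x) = 4 * cos x ^+ 2).
  have -> : semi (2 * sin x) = Num.sqrt ((2 * cos x) ^+ 2).
    by congr Num.sqrt; rewrite !exprMn sin2cos2; ring.
  rewrite sqrtr_sqr ger0_norm; last by rewrite mulr_ge0// cos_ge0_pihalf.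
  by ring.
rewrite (@continuous_FTC2 _ _ G)//.
- by rewrite /G cosN cos_pihalf !mulr0 !addr0 -EFinB; congr EFin; field.
- apply: continuous_subspaceT => x; apply: cvgM; first exact: cvg_cst.
  apply: (@continuous_comp _ _ _ (@cos R) (fun y => y ^+ 2)).
    exact: continuous_cos.
  exact: exprn_continuous.
- by apply: derivable_LRcontinuous => x; exact: ex_derive.
- by move=> x _; rewrite derive1E; exact: derive_val.
Qed.

Lemma is_derive_4BX2 (x : R) :
  is_derive x (1 : R) (fun x : R => 4 - x ^+ 2) (- (2 * x)).
Proof.
have h : is_derive x (1 : R) (cst 4 - (id : R -> R) ^+ 2)
    (0 - ((2%:R * x ^+ 1) *: 1)) by apply: is_deriveB.
by apply: is_derive_eq h _; rewrite /GRing.scale /=; ring.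
Qed.

Lemma is_derive_Xn (x : R) p :
  is_derive x (1 : R) (fun x : R => x ^+ p) (p%:R * x ^+ p.-1).
Proof.
have := is_deriveX p (is_derive_id x (1 : R)); rewrite exprfctE => h.
by apply: is_derive_eq h _; rewrite /GRing.scale /= mulr1.
Qed.

Lemma is_derive_semi (x : R) : -2 < x < 2 ->
  is_derive x (1 : R) semi (- (x / semi x)).
Proof.
move=> /andP[x1 x2].
have x4 : 0 < 4 - x ^+ 2 by nra.
have h := @is_derive1_comp _ Num.sqrt (fun x : R => 4 - x ^+ 2) x _ _
  (is_derive1_sqrt x4) (is_derive_4BX2 x).
apply: is_derive_eq h _; rewrite /semi.
have s0 : Num.sqrt (4 - x ^+ 2) != 0 by rewrite gt_eqF// sqrtr_gt0.
by field.
Qed.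

(** The integrand is the derivative of x^p (4 - x^2)^(3/2), which vanishes at both ends. At p = 0
    the truncated [p.-1] is killed by the factor p. *)
Lemma integral_stein p :
  (\int[mu]_(x in seg) ((p%:R * x ^+ p.-1 * (4 - x ^+ 2) - 3 * x ^+ p.+1) * semi x)%:E
   = 0)%E.
Proof.
pose F := fun x : R => x ^+ p * (4 - x ^+ 2) * semi x.
have cF : continuous F.
  move=> x; apply: cvgM; last exact: continuous_semi.
  by apply: cvgM; [exact: exprn_continuous|exact: continuous_poly2].
have dF (x : R) : -2 < x < 2 -> is_derive x (1 : R) F
    ((p%:R * x ^+ p.-1 * (4 - x ^+ 2) - 3 * x ^+ p.+1) * semi x).
  move=> xI; have h := is_deriveM (is_deriveM (is_derive_Xn x p) (is_derive_4BX2 x))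
    (is_derive_semi xI).
  apply: is_derive_eq h _.
  change (x ^+ p * (4 - x ^+ 2) * - (x / semi x) + semi x *
    (x ^+ p * - (2 * x) + (4 - x ^+ 2) * (p%:R * x ^+ p.-1)) =
    (p%:R * x ^+ p.-1 * (4 - x ^+ 2) - 3 * x ^+ p.+1) * semi x).
  have /andP[x1 x2] := xI.
  have s0 : semi x != 0 by rewrite gt_eqF// sqrtr_gt0; nra.
  rewrite -(@sqr_semi x); last by rewrite !ltW.
  by rewrite [x ^+ p.+1]exprS; field.
rewrite (@continuous_FTC2 _ _ F).
- have s2 : semi 2 = 0 /\ semi (- 2) = 0.
    have e : 4 - 2 ^+ 2 = 0 :> R by ring.
    by rewrite /semi sqrrN e sqrtr0.
  by rewrite /F s2.1 s2.2 !mulr0 subee.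
- lra.
- apply: continuous_subspaceT => x; apply: cvgM; last exact: continuous_semi.
  apply: cvgB; apply: cvgM; try apply: cvgM; try exact: cvg_cst;
    try exact: exprn_continuous; exact: continuous_poly2.
- split=> [x xI||]; first by apply: ex_derive; exact: dF.
    by apply: cvg_at_right_filter; exact: cF.
  by apply: cvg_at_left_filter; exact: cF.
- by move=> x xI; rewrite derive1E; apply: derive_val; exact: dF.
Qed.

Lemma integral_semi_seg (f : R -> R) :
  (\int[mu]_x (f x * semi x)%:E = \int[mu]_(x in seg) (f x * semi x)%:E)%E.
Proof.
rewrite [RHS]integral_mkcond; apply: eq_integral => x _.
rewrite patchE; case: ifPn => // xI.
by rewrite semi_out ?mulr0//; apply: contra xI; rewrite inE.
Qed.

Lemma integrable_semi (f : R -> R) : continuous f ->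
  mu.-integrable setT (fun x => (f x * semi x)%:E).
Proof.
move=> cf; have cfs : continuous (fun x => f x * semi x).
  by move=> x; apply: cvgM; [exact: cf|exact: continuous_semi].
have : mu.-integrable seg (EFin \o (fun x => f x * semi x)).
  apply: continuous_compact_integrable; first exact: segment_compact.
  exact: continuous_subspaceT.
move/integrable_mkcond => /(_ (measurable_itv _)).
apply: eq_integrable => // x _ /=; rewrite patchE; case: ifPn => // xI.
by rewrite semi_out ?mulr0//; apply: contra xI; rewrite inE.
Qed.

Definition semi_pdf (x : R) : R := semi x / (2 * pi).

Lemma semi_pdf_ge0 x : 0 <= semi_pdf x.
Proof. by rewrite divr_ge0 ?semi_ge0// mulr_ge0// pi_ge0. Qed.

Lemma continuous_semi_pdf : continuous semi_pdf.
Proof. by move=> x; apply: cvgM; [exact: continuous_semi|exact: cvg_cst]. Qed.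

Lemma semi_pdf_out x : x \notin `[-2, 2] -> semi_pdf x = 0.
Proof. by move=> xI; rewrite /semi_pdf semi_out ?mul0r. Qed.

Definition semiE (f : R -> R) : R := (\int[mu]_x (f x * semi_pdf x))%R.

Definition semimom (p : nat) : R := semiE (fun x => x ^+ p).

Lemma integrable_semi_pdf (f : R -> R) : continuous f ->
  mu.-integrable setT (fun x => (f x * semi_pdf x)%:E).
Proof.
move=> cf; have := integrableZl measurableT (2 * pi)^-1 (integrable_semi cf).
by apply: eq_integrable => // x _; rewrite -EFinM; congr EFin; rewrite [LHS]mulrC -mulrA.
Qed.

Lemma integral_semi_pdf (f : R -> R) : continuous f ->
  (\int[mu]_x (f x * semi_pdf x)%:E = (semiE f)%:E)%E.
Proof.
move=> cf; rewrite /semiE /Rintegral fineK//.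
by apply: integrable_fin_num => //; exact: integrable_semi_pdf.
Qed.

Lemma semiE_seg (f : R -> R) : continuous f ->
  (semiE f)%:E = ((2 * pi)^-1%:E * \int[mu]_(x in seg) (f x * semi x)%:E)%E.
Proof.
move=> cf; rewrite -integral_semi_pdf// -integral_semi_seg.
rewrite -integralZl//; last exact: integrable_semi.
by apply: eq_integral => x _; rewrite -EFinM; congr EFin; rewrite [RHS]mulrC -mulrA.
Qed.

Lemma semiED (f g : R -> R) : continuous f -> continuous g ->
  semiE (fun x => f x + g x) = semiE f + semiE g.
Proof.
move=> cf cg; rewrite /semiE -RintegralD//; [|exact: integrable_semi_pdf..].
by apply: eq_Rintegral => x _; rewrite mulrDl.
Qed.

Lemma semiEZ (k : R) (f : R -> R) : continuous f ->
  semiE (fun x => k * f x) = k * semiE f.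
Proof.
move=> cf; rewrite /semiE -RintegralZl//; last exact: integrable_semi_pdf.
by apply: eq_Rintegral => x _; rewrite mulrA.
Qed.

Lemma continuous_sumr n (F : 'I_n -> R -> R) : (forall i, continuous (F i)) ->
  continuous (fun x => \sum_i F i x).
Proof.
elim: n F => [|n IHn] F cF.
  by under eq_fun do rewrite big_ord0; move=> x; exact: cvg_cst.
rewrite (_ : (fun x => _) = (fun x => F ord0 x + \sum_i F (lift ord0 i) x)).
  by move=> x; apply: cvgD; [exact: cF|exact: IHn].
by apply/funext => x; rewrite big_ord_recl.
Qed.

Lemma semiE_sum n (F : 'I_n -> R -> R) : (forall i, continuous (F i)) ->
  semiE (fun x => \sum_i F i x) = \sum_i semiE (F i).
Proof.
elim: n F => [|n IHn] F cF.
  rewrite big_ord0 /semiE; under eq_Rintegral do rewrite big_ord0 mul0r.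
  by rewrite Rintegral_cst// mul0r.
rewrite big_ord_recl -IHn// -semiED//; last exact: continuous_sumr.
by congr semiE; apply/funext => x; rewrite big_ord_recl.
Qed.

Lemma semimom0 : semimom 0 = 1.
Proof.
apply/EFin_inj; rewrite /semimom semiE_seg; last exact: exprn_continuous.
under eq_integral do rewrite expr0 mul1r.
rewrite integral_semi_itv -EFinM mulVf// mulf_neq0//.
by rewrite gt_eqF// pi_gt0.
Qed.

Lemma semiE_stein p :
  semiE (fun x => p%:R * x ^+ p.-1 * (4 - x ^+ 2) - 3 * x ^+ p.+1) = 0.
Proof.
apply/EFin_inj; rewrite semiE_seg ?integral_stein ?mule0// => x.
apply: cvgB; apply: cvgM; try apply: cvgM; try exact: cvg_cst;
  try exact: exprn_continuous; exact: continuous_poly2.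
Qed.

Lemma semimom1 : semimom 1 = 0.
Proof.
have := semiE_stein 0.
have -> : (fun x : R => 0%:R * x ^+ 0.-1 * (4 - x ^+ 2) - 3 * x ^+ 1) =
  fun x => -3 * x ^+ 1 by apply/funext => x; ring.
rewrite semiEZ; last exact: exprn_continuous.
by rewrite -/(semimom 1); lra.
Qed.

Lemma semimomS p : (p%:R + 4) * semimom p.+2 = 4 * (p%:R + 1) * semimom p.
Proof.
have := semiE_stein p.+1; rewrite /=.
have -> : (fun x : R => p.+1%:R * x ^+ p * (4 - x ^+ 2) - 3 * x ^+ p.+2) =
  fun x => (4 * (p%:R + 1)) * x ^+ p + (- (p%:R + 4)) * x ^+ p.+2.
  by apply/funext => x; rewrite -natr1 !exprS; ring.
have cZ (k : R) n : continuous (fun x : R => k * x ^+ n).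
  by move=> x; apply: cvgM; [exact: cvg_cst|exact: exprn_continuous].
rewrite semiED// !semiEZ; try exact: exprn_continuous.
by rewrite -!/(semimom _); lra.
Qed.

End semicircle.

(** * Weighted convolution of two semicircle laws *)

Section trace_laws.
Variable R : realType.
Local Notation mu := (@lebesgue_measure R).

Lemma integral_affine (f : R -> R) (a b : R) : 0 < a -> continuous f ->
  (forall x, 0 <= f x) ->
  (\int[mu]_x (f x)%:E = \int[mu]_x (a * f (a * x + b))%:E)%E.
Proof.
move=> a0 cf f0; pose F := fun x : R => a * x + b.
have dF (x : R) : is_derive x (1 : R) F a.
  have h : is_derive x (1 : R) (a \*: (id : R -> R) + cst b) (a *: 1 + 0).
    by apply: is_deriveD.
  by apply: is_derive_eq h _; rewrite /GRing.scale /= mulr1 addr0.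
have F' : derive1 F = cst a.
  by apply/funext => x; rewrite derive1E; exact: derive_val.
rewrite (@increasing_ge0_integration_by_substitutionT _ F)// ?F'.
- by apply: eq_integral => x _; congr EFin; rewrite /= mulrC.
- by move=> x y xy; rewrite /F ltrD2r ltr_pM2l.
- exact: cst_continuous.
- exact: is_cvg_cst.
- exact: is_cvg_cst.
- apply/cvgrNyPle => A; near=> x.
  have : x <= (A - b) / a by near: x; apply: nbhs_ninfty_le; exact: num_real.
  by rewrite ler_pdivlMr// /F mulrC -lerBrDr.
- apply/cvgryPge => A; near=> x.
  have : (A - b) / a <= x by near: x; apply: nbhs_pinfty_ge; exact: num_real.
  by rewrite ler_pdivrMr// /F [a * x]mulrC -lerBlDr.
Unshelve. all: by end_near. Qed.

(** What makes an iterated semicircle expectation linear: both the inner and the outer integrand are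
    continuous, hence integrable against a density with compact support. *)
Definition tame (f : R -> R -> R) :=
  (forall x, continuous (f x)) /\ continuous (fun x => semiE (f x)).

Definition semiE2 (f : R -> R -> R) : R := semiE (fun x => semiE (f x)).

Lemma tameD f g : tame f -> tame g -> tame (fun x y => f x y + g x y).
Proof.
move=> [cf cf'] [cg cg']; split=> x; first by move=> y; apply: cvgD; [exact: cf|exact: cg].
rewrite (_ : (fun x => _) = (fun x => semiE (f x) + semiE (g x))).
  by apply: cvgD; [exact: cf'|exact: cg'].
by apply/funext => z; rewrite semiED.
Qed.

Lemma tameZ k f : tame f -> tame (fun x y => k * f x y).
Proof.
move=> [cf cf']; split=> x.
  by move=> y; apply: cvgM; [exact: cvg_cst|exact: cf].
rewrite (_ : (fun x => _) = (fun x => k * semiE (f x))).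
  by apply: cvgM; [exact: cvg_cst|exact: cf'].
by apply/funext => z; rewrite semiEZ.
Qed.

Lemma semiE2D f g : tame f -> tame g ->
  semiE2 (fun x y => f x y + g x y) = semiE2 f + semiE2 g.
Proof.
move=> [cf cf'] [cg cg']; rewrite /semiE2 -semiED//; congr semiE.
by apply/funext => x; rewrite semiED.
Qed.

Lemma semiE2Z k f : tame f -> semiE2 (fun x y => k * f x y) = k * semiE2 f.
Proof.
move=> [cf cf']; rewrite /semiE2 -semiEZ//; congr semiE.
by apply/funext => x; rewrite semiEZ.
Qed.

Lemma tame_sum n (f : 'I_n -> R -> R -> R) : (forall i, tame (f i)) ->
  tame (fun x y => \sum_i f i x y) /\
  semiE2 (fun x y => \sum_i f i x y) = \sum_i semiE2 (f i).
Proof.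
elim: n f => [|n IHn] f tf.
  have -> : (fun x y => \sum_i f i x y) = fun x y => 0.
    by apply/funext => x; apply/funext => y; rewrite big_ord0.
  have semiE0 : semiE (fun=> 0 : R) = 0.
    rewrite /semiE; under eq_Rintegral do rewrite mul0r.
    by rewrite Rintegral_cst// mul0r.
  split; last by rewrite big_ord0 /semiE2 !semiE0.
  by split=> x; [|rewrite semiE0]; exact: cst_continuous.
have -> : (fun x y => \sum_i f i x y) =
    fun x y => f ord0 x y + \sum_i f (lift ord0 i) x y.
  by apply/funext => x; apply/funext => y; rewrite big_ord_recl.
have [t e] := IHn (fun i => f (lift ord0 i)) (fun i => tf _).
by split; [exact: tameD|rewrite semiE2D// big_ord_recl e].
Qed.

(** The inner expectation is a polynomial in x, which gives both tameness and the binomial sum. *)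
Lemma semiE2_monomial n i j :
  tame (fun x y => (x + y) ^+ n * (x ^+ i * y ^+ j)) /\
  semiE2 (fun x y => (x + y) ^+ n * (x ^+ i * y ^+ j)) =
  mixmom (@semimom R) n i j.
Proof.
have E x : semiE (fun y => (x + y) ^+ n * (x ^+ i * y ^+ j)) =
    \sum_(p < n.+1) ('C(n, p)%:R * semimom R (n - p + j)) * x ^+ (p + i).
  pose F (p : 'I_n.+1) y := ('C(n, p)%:R * x ^+ (p + i)) * y ^+ (n - p + j).
  have cF p : continuous (F p).
    by move=> y; apply: cvgM; [exact: cvg_cst|exact: exprn_continuous].
  transitivity (semiE (fun y => \sum_p F p y)).
    congr semiE; apply/funext => y; rewrite addrC exprDn mulr_suml.
    by apply: eq_bigr => p _; rewrite /F -[_ *+ 'C(n, p)]mulr_natl !exprD; ring.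
  rewrite semiE_sum//; apply: eq_bigr => p _.
  rewrite /F semiEZ; last exact: exprn_continuous.
  exact: mulrAC.
have cE (p : 'I_n.+1) : continuous (fun x : R =>
    ('C(n, p)%:R * semimom R (n - p + j)) * x ^+ (p + i)).
  by move=> x; apply: cvgM; [exact: cvg_cst|exact: exprn_continuous].
split; last first.
  rewrite /semiE2 (_ : (fun x => _) = (fun x => \sum_(p < n.+1)
    ('C(n, p)%:R * semimom R (n - p + j)) * x ^+ (p + i))); last exact/funext.
  rewrite semiE_sum//; apply: eq_bigr => p _.
  rewrite semiEZ; last exact: exprn_continuous.
  by rewrite -mulrA [semimom R (n - p + j) * _]mulrC.
split=> x.
  move=> y; apply: cvgM.
    apply: (@continuous_comp _ _ _ (fun y => x + y) (fun y => y ^+ n)).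
      by apply: cvgD; [exact: cvg_cst|exact: cvg_id].
    exact: exprn_continuous.
  by apply: cvgM; [exact: cvg_cst|exact: exprn_continuous].
rewrite (_ : (fun x => _) = (fun x => \sum_(p < n.+1)
    ('C(n, p)%:R * semimom R (n - p + j)) * x ^+ (p + i))); last exact/funext.
exact: continuous_sumr.
Qed.

Variables al be : R.
Hypotheses (al0 : 0 <= al) (be0 : 0 <= be).

(* Weyl's density on pairs of traces: [al = 1, be = 0] for SU(2) x SU(2) and
   [al = 0, be = 1] for USp(4). *)
Definition weyl (x y : R) : R := al + be * ((x - y) ^+ 2 / 2).

Definition weylmom n : R :=
  al * mixmom (@semimom R) n 0 0 +
  be * (mixmom (@semimom R) n 2 0 - mixmom (@semimom R) n 1 1).

Lemma weyl_ge0 x y : 0 <= weyl x y.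
Proof. by rewrite addr_ge0// mulr_ge0// divr_ge0// sqr_ge0. Qed.

(** (x - y)^2 / 2 is (x^2 + y^2) / 2 - x y, and by symmetry x^2 and y^2 contribute equally. *)
Lemma semiE2_weyl n :
  tame (fun x y => (x + y) ^+ n * weyl x y) /\
  semiE2 (fun x y => (x + y) ^+ n * weyl x y) = weylmom n.
Proof.
have [t00 e00] := semiE2_monomial n 0 0; have [t20 e20] := semiE2_monomial n 2 0.
have [t11 e11] := semiE2_monomial n 1 1; have [t02 e02] := semiE2_monomial n 0 2.
have tZ k i j := tameZ k (semiE2_monomial n i j).1.
have -> : (fun x y => (x + y) ^+ n * weyl x y) = (fun x y =>
    al * ((x + y) ^+ n * (x ^+ 0 * y ^+ 0)) +
    (be / 2 * ((x + y) ^+ n * (x ^+ 2 * y ^+ 0)) +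
     ((- be) * ((x + y) ^+ n * (x ^+ 1 * y ^+ 1)) +
      be / 2 * ((x + y) ^+ n * (x ^+ 0 * y ^+ 2))))).
  by apply/funext => x; apply/funext => y; rewrite /weyl; field.
have t1 := tameD (tZ (- be) 1%N 1%N) (tZ (be / 2) 0%N 2%N).
have t2 := tameD (tZ (be / 2) 2%N 0%N) t1.
split; first exact: tameD (tZ al 0%N 0%N) t2.
rewrite !semiE2D// !semiE2Z// e00 e20 e11 e02.
by rewrite /weylmom (mixmom_sym _ n 0 2); field.
Qed.

Lemma semiE2_horner (q : {poly R}) :
  tame (fun x y => q.[x + y] * weyl x y) /\
  semiE2 (fun x y => q.[x + y] * weyl x y) = \sum_(i < size q) q`_i * weylmom i.
Proof.
have -> : (fun x y => q.[x + y] * weyl x y) =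
    (fun x y => \sum_(i < size q) q`_i * ((x + y) ^+ i * weyl x y)).
  apply/funext => x; apply/funext => y; rewrite horner_coef mulr_suml.
  by apply: eq_bigr => i _; rewrite mulrA.
have tq (i : 'I_(size q)) := tameZ q`_i (semiE2_weyl i).1.
have [t ->] := tame_sum tq; split=> //.
by apply: eq_bigr => i _; rewrite semiE2Z ?(semiE2_weyl i).2//; exact: (semiE2_weyl i).1.
Qed.

Definition trace_density (e : R) : R :=
  semiE (fun x => weyl x (e - 4 - x) * semi_pdf (e - 4 - x)).

(** The integrand in the coordinates (x, e) with e = x + y + 4. Integrating in x yields the density
    of e, integrating in e the expectation over y. *)
Let joint (q : {poly R}) (z : R * R) : R :=
  q.[z.2 - 4] * (weyl z.1 (z.2 - 4 - z.1) * semi_pdf (z.2 - 4 - z.1) * semi_pdf z.1).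

Lemma measurable_joint q : measurable_fun setT (joint q).
Proof.
have m1 : measurable_fun setT (fun z : R * R => z.1) by exact: measurable_fst.
have m2 : measurable_fun setT (fun z : R * R => z.2 - 4).
  by apply: measurable_funB => //; exact: measurable_snd.
have m3 : measurable_fun setT (fun z : R * R => z.2 - 4 - z.1).
  exact: measurable_funB.
have mw : measurable_fun setT (@semi_pdf R).
  by apply: continuous_measurable_fun; exact: continuous_semi_pdf.
apply: measurable_funM.
  apply: (measurableT_comp (f := horner q)) => //.
  by apply: continuous_measurable_fun; exact: continuous_horner.
apply: measurable_funM; last exact: measurableT_comp mw m1.
apply: measurable_funM; last exact: measurableT_comp mw m3.
apply: measurable_funD => //; apply: measurable_funM => //.
by apply: measurable_funM => //; apply: measurable_funX; exact: measurable_funB.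
Qed.

(** Both x and y are confined to [-2, 2] by the semicircle factors, so q is evaluated only on
    [-4, 4] wherever the product is nonzero. *)
Lemma joint_ge0 (q : {poly R}) : (forall s, -4 <= s <= 4 -> 0 <= q.[s]) ->
  forall z, 0 <= joint q z.
Proof.
move=> q0 [x e]; rewrite /joint /=.
have [xI|xI] := boolP (x \in `[-2, 2]); last by rewrite (semi_pdf_out xI) !mulr0.
have [yI|yI] := boolP (e - 4 - x \in `[-2, 2]); last first.
  by rewrite (semi_pdf_out yI) mulr0 mul0r mulr0.
rewrite mulr_ge0//; last first.
  by rewrite mulr_ge0// ?semi_pdf_ge0// mulr_ge0 ?weyl_ge0 ?semi_pdf_ge0.
apply: q0; move: xI yI; rewrite !in_itv /= => /andP[? ?] /andP[? ?]; lra.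
Qed.

Lemma continuous_weyl_diag (s : R) : continuous (fun x => weyl x (s - x)).
Proof.
move=> x; have cs : continuous (fun x : R => x - (s - x)).
  by move=> y; apply: cvgB; [exact: cvg_id|apply: cvgB; [exact: cvg_cst|exact: cvg_id]].
apply: cvgD; first exact: cvg_cst.
apply: cvgM; first exact: cvg_cst.
apply: cvgM; last exact: cvg_cst.
exact: (@continuous_comp _ _ _ (fun x => x - (s - x)) (fun y => y ^+ 2) _ (cs x)
  (@exprn_continuous _ _ _)).
Qed.

Lemma continuous_semi_pdf_diag (s : R) : continuous (fun x : R => semi_pdf (s - x)).
Proof.
move=> x; apply: (@continuous_comp _ _ _ (fun x => s - x) (@semi_pdf R)).
  by apply: cvgB; [exact: cvg_cst|exact: cvg_id].
exact: continuous_semi_pdf.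
Qed.

Lemma continuous_dens_integrand (s : R) :
  continuous (fun x => weyl x (s - x) * semi_pdf (s - x)).
Proof.
move=> x; apply: cvgM; first exact: continuous_weyl_diag.
exact: continuous_semi_pdf_diag.
Qed.

Lemma trace_density_ge0 e : 0 <= trace_density e.
Proof.
apply: Rintegral_ge0 => x _.
by apply: mulr_ge0; [apply: mulr_ge0; [exact: weyl_ge0|]|]; exact: semi_pdf_ge0.
Qed.

Lemma integral_joint_fst q e :
  (\int[mu]_x (joint q (x, e))%:E = (q.[e - 4] * trace_density e)%:E)%E.
Proof.
have c := @continuous_dens_integrand (e - 4).
rewrite /trace_density -semiEZ// -integral_semi_pdf//.
  by apply: eq_integral => x _; congr EFin; rewrite /joint /= !mulrA.
by move=> x; apply: cvgM; [exact: cvg_cst|exact: c].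
Qed.

(** A partial integral of the nonnegative function [joint 1], hence measurable by Tonelli. *)
Lemma measurable_trace_density : measurable_fun setT trace_density.
Proof.
have mj : measurable_fun setT (EFin \o joint 1).
  by apply/measurable_EFinP; exact: measurable_joint.
have j0 z : (0 <= (EFin \o joint 1) z)%E.
  by rewrite /= lee_fin joint_ge0// => s _; rewrite hornerC.
apply/measurable_EFinP.
have := @measurable_fun_fubini_tonelli_G _ _ _ _ R mu _ mj j0.
apply: eq_measurable_fun => e _.
by rewrite /fubini_G integral_joint_fst hornerC mul1r.
Qed.

Lemma integral_joint_snd (q : {poly R}) x :
  (forall s, -4 <= s <= 4 -> 0 <= q.[s]) ->
  (\int[mu]_e (joint q (x, e))%:E =
   (semiE (fun y => q.[x + y] * weyl x y) * semi_pdf x)%:E)%E.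
Proof.
move=> q0; have [tc _] := (semiE2_horner q).1.
rewrite (@integral_affine (fun e => joint q (x, e)) 1 (x + 4))//.
- rewrite mulrC -semiEZ// -integral_semi_pdf.
    apply: eq_integral => y _; congr EFin; rewrite /joint /= !mul1r.
    have -> : y + (x + 4) - 4 - x = y by ring.
    have -> : y + (x + 4) - 4 = x + y by ring.
    by ring.
  by move=> y; apply: cvgM; [exact: cvg_cst|exact: tc].
- have c1 : continuous (fun e : R => q.[e - 4]).
    move=> e; apply: (@continuous_comp _ _ _ (fun e : R => e - 4) (horner q)).
      by apply: cvgB; [exact: cvg_id|exact: cvg_cst].
    exact: continuous_horner.
  have c2 : continuous (fun y => weyl x y * semi_pdf y).
    move=> y; apply: cvgM; last exact: continuous_semi_pdf.
    have c := (semiE2_horner 1%:P).1.1 x.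
    have -> : weyl x = fun y => 1%:P.[x + y] * weyl x y.
      by apply/funext => z; rewrite hornerC mul1r.
    exact: c.
  have c3 : continuous (fun e : R => weyl x (e - 4 - x) * semi_pdf (e - 4 - x)).
    move=> e; apply: (@continuous_comp _ _ _ (fun e : R => e - 4 - x)
      (fun y => weyl x y * semi_pdf y)); last exact: c2.
    by apply: cvgB; [apply: cvgB; [exact: cvg_id|exact: cvg_cst]|exact: cvg_cst].
  move=> e; rewrite /joint /=; apply: cvgM; first exact: c1.
  by apply: cvgM; [exact: c3|exact: cvg_cst].
- by move=> e; exact: joint_ge0.
Qed.

(** Positivity of q on [-4, 4] makes the integrand nonnegative, so Tonelli exchanges the two
    integrals. *)
Lemma trace_density_moments (q : {poly R}) : (forall s, -4 <= s <= 4 -> 0 <= q.[s]) ->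
  (\int[mu]_e (q.[e - 4] * trace_density e)%:E = (\sum_(i < size q) q`_i * weylmom i)%:E)%E.
Proof.
move=> q0; under eq_integral do rewrite -integral_joint_fst.
rewrite -(@fubini_tonelli _ _ _ _ R mu mu (fun z => (joint q z)%:E)); first last.
- by move=> z; rewrite lee_fin joint_ge0.
- by apply/measurable_EFinP; exact: measurable_joint.
under eq_integral do rewrite integral_joint_snd//.
have [[_ c] <-] := semiE2_horner q.
exact: integral_semi_pdf.
Qed.

End trace_laws.

(** * Determination of a law by its moments *)

Section threshold.
Variable R : realType.

Lemma bernoulli_expB (a : R) n : 0 <= a <= 1 -> 1 - n%:R * a <= (1 - a) ^+ n.
Proof.
move=> /andP[a0 a1]; elim: n => [|n IHn]; first by rewrite mul0r subr0 expr0.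
rewrite exprS; apply: (@le_trans _ _ ((1 - a) * (1 - n%:R * a))).
  have : 0 <= n%:R * a ^+ 2 by rewrite mulr_ge0// sqr_ge0.
  by rewrite -natr1; nra.
by rewrite ler_wpM2l// subr_ge0.
Qed.

Lemma bernoulli_expD (a : R) n : 0 <= a -> 1 + n%:R * a <= (1 + a) ^+ n.
Proof.
move=> a0; elim: n => [|n IHn]; first by rewrite mul0r addr0 expr0.
rewrite exprS; apply: (@le_trans _ _ ((1 + a) * (1 + n%:R * a))).
  have : 0 <= n%:R * a ^+ 2 by rewrite mulr_ge0// sqr_ge0.
  by rewrite -natr1; nra.
by rewrite ler_wpM2l// addr_ge0.
Qed.

(** From (1 - a)^n (1 + a)^n <= 1 and Bernoulli's inequality for 1 + a. *)
Lemma expB_le_invD (a : R) n : 0 <= a <= 1 -> (1 - a) ^+ n <= (1 + n%:R * a)^-1.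
Proof.
move=> /andP[a0 a1].
have na : 0 < 1 + n%:R * a by rewrite ltr_wpDr// mulr_ge0.
rewrite -[leRHS]mul1r ler_pdivlMr//.
apply: (@le_trans _ _ ((1 - a) ^+ n * (1 + a) ^+ n)).
  by rewrite ler_wpM2l ?bernoulli_expD// exprn_ge0// subr_ge0.
by rewrite -exprMn exprn_ile1//; nra.
Qed.

(** n y^n is at most 1 + y + ... + y^(n-1); the induction proves this with the geometric sum
    multiplied by 1 - y. *)
Lemma mulrn_expr_le (y : R) n : 0 <= y < 1 -> n%:R * y ^+ n <= (1 - y)^-1.
Proof.
move=> /andP[y0 y1]; have y1' : 0 < 1 - y by rewrite subr_gt0.
rewrite -[leRHS]mul1r ler_pdivlMr//.
have : n%:R * y ^+ n * (1 - y) <= 1 - y ^+ n.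
  elim: n => [|n IHn]; first by rewrite !mul0r expr0 subrr.
  have z0 := exprn_ge0 n y0; have z1 : y ^+ n <= 1 by rewrite exprn_ile1// ltW.
  rewrite exprS -natr1; apply: (@le_trans _ _ (y * (1 - y ^+ n) + y * y ^+ n * (1 - y))).
    rewrite mulrDl mulrDl; apply: lerD; last by rewrite mul1r.
    by rewrite mulrCA -!mulrA ler_wpM2l// mulrA.
  have : 0 <= (1 - y) * (1 - y * y ^+ n).
    by rewrite mulr_ge0 ?subr_ge0 ?ltW//; nra.
  by lra.
by move/le_trans; apply; rewrite gerBl exprn_ge0.
Qed.

(** With y the square root of x, n x^n = (n y^n) y^n, where the first factor is bounded. *)
Lemma cvg_mulrn_expr (x : R) : 0 <= x < 1 -> n%:R * x ^+ n @[n --> \oo] --> 0.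
Proof.
move=> /andP[x0 x1]; pose y := Num.sqrt x.
have y01 : 0 <= y < 1 by rewrite sqrtr_ge0 -sqrtr1 ltr_sqrt.
have [y0 y1] := andP y01.
have xy n : x ^+ n = y ^+ n * y ^+ n by rewrite -expr2 exprAC sqr_sqrtr.
apply: (squeeze_cvgr (f := fun=> 0) (h := fun n => (1 - y)^-1 * y ^+ n)).
- apply: nearW => n; rewrite mulr_ge0 ?exprn_ge0//= xy mulrA.
  by rewrite ler_wpM2r ?exprn_ge0// mulrn_expr_le.
- exact: cvg_cst.
- rewrite -[X in _ --> X](mulr0 (1 - y)^-1); apply: cvgM; first exact: cvg_cst.
  by apply: cvg_expr; rewrite ger0_norm.
Qed.

(* The factor n in the exponent settles the borderline case t = 1/2. *)
Lemma cvg_threshold (t : R) : 0 <= t <= 1 ->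
  (1 - t ^+ n) ^+ (n * 2 ^ n) @[n --> \oo] --> ((t < 1 / 2)%R%:R : R).
Proof.
move=> /andP[t0 t1].
have tn n : 0 <= t ^+ n <= 1 by rewrite exprn_ge0//= exprn_ile1.
have nE n : (n * 2 ^ n)%:R * t ^+ n = n%:R * (2 * t) ^+ n.
  by rewrite natrM natrX exprMn mulrA.
have [t2|t2] := ltP t (1 / 2) => /=.
  apply: (squeeze_cvgr (f := fun n => 1 - n%:R * (2 * t) ^+ n) (h := fun=> 1)).
  - apply: nearW => n; rewrite -nE bernoulli_expB//=.
    by have /andP[? ?] := tn n; rewrite exprn_ile1// ?subr_ge0// gerBl.
  - rewrite -[X in _ --> X]subr0; apply: cvgB; first exact: cvg_cst.
    by apply: cvg_mulrn_expr; lra.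
  - exact: cvg_cst.
(* For 2 t >= 1 the power is at most 1 / (1 + n (2 t)^n) <= 1 / (n + 1). *)
apply: (squeeze_cvgr (f := fun=> 0) (h := @harmonic R)).
- apply: nearW => n; have /andP[tn0 tn1] := tn n.
  rewrite exprn_ge0 ?subr_ge0//=; apply: le_trans (expB_le_invD _ (tn n)) _.
  rewrite nE /harmonic lef_pV2 ?posrE//; last first.
    by rewrite ltr_wpDr// mulr_ge0// exprn_ge0//; lra.
  rewrite -natr1 addrC lerD2l ler_peMr// exprn_ege1//; lra.
- exact: cvg_cst.
- exact: cvg_harmonic.
Qed.

(** The affine map taking c to 1/2; it sends [-4, 4] into [0, 1] as soon as L >= 4 + |c|. *)
Definition threshold_arg (L c : R) : {poly R} := (1 / 2)%:P + (2 * L)^-1 *: ('X - c%:P).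

Definition threshold_poly (L c : R) (n : nat) : {poly R} :=
  (1 - threshold_arg L c ^+ n) ^+ (n * 2 ^ n).

Lemma horner_threshold_poly L c n s : (threshold_poly L c n).[s] =
  (1 - (1 / 2 + (s - c) / (2 * L)) ^+ n) ^+ (n * 2 ^ n).
Proof.
by rewrite /threshold_poly /threshold_arg !(hornerE, horner_exp) /= [_^-1 * _]mulrC.
Qed.

Lemma threshold_arg01 (L c s : R) : 4 + `|c| <= L -> -4 <= s <= 4 ->
  0 <= 1 / 2 + (s - c) / (2 * L) <= 1.
Proof.
move=> cL s4; have /andP[s1 s2] := s4.
have [c1 c2] : c <= `|c| /\ - c <= `|c| by rewrite ler_norm -normrN ler_norm.
have L0 : 0 < L by apply: lt_le_trans cL; rewrite ltr_pwDl.
have e : (s - c) / (2 * L) = (s - c) / L / 2 by field; rewrite gt_eqF.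
have h1 : -1 <= (s - c) / L by rewrite ler_pdivlMr//; lra.
have h2 : (s - c) / L <= 1 by rewrite ler_pdivrMr//; lra.
rewrite e; lra.
Qed.

Lemma threshold_poly_itv01 (L c s : R) n : 4 + `|c| <= L -> -4 <= s <= 4 ->
  0 <= (threshold_poly L c n).[s] <= 1.
Proof.
move=> cL /(threshold_arg01 cL); rewrite horner_threshold_poly.
move: (_ + _) => t /andP[t0 t1].
have tn : 0 <= t ^+ n <= 1 by rewrite exprn_ge0//= exprn_ile1.
have /andP[? ?] := tn.
by rewrite exprn_ge0 ?subr_ge0//= exprn_ile1// ?subr_ge0// gerBl.
Qed.

Lemma cvg_threshold_poly (L c s : R) : 4 + `|c| <= L -> -4 <= s <= 4 ->
  (threshold_poly L c n).[s] @[n --> \oo] --> ((s < c)%R%:R : R).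
Proof.
move=> cL s4; under eq_fun do rewrite horner_threshold_poly.
have L0 : 0 < L by apply: lt_le_trans cL; rewrite ltr_pwDl.
have -> : (s < c) = (1 / 2 + (s - c) / (2 * L) < 1 / 2).
  by rewrite gtrDl pmulr_llt0 ?subr_lt0// invr_gt0 mulr_gt0.
by apply: cvg_threshold; exact: threshold_arg01.
Qed.

End threshold.

(** * Comparison of measures on rays *)

Section density_measure.
Variables (R : realType) (dn : R -> R).
Hypotheses (mdn : measurable_fun setT dn) (dn_ge0 : forall e, 0 <= dn e).
Local Notation leb := (@lebesgue_measure R).

Definition density_mass (A : set R) : \bar R := (\int[leb]_(e in A) (dn e)%:E)%E.

Let mdens0 : density_mass set0 = 0%E.
Proof. exact: integral_set0. Qed.

Let mdens_ge0 A : (0 <= density_mass A)%E.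
Proof. by apply: integral_ge0 => e _; rewrite lee_fin. Qed.

Let mdens_sigma_additive : semi_sigma_additive density_mass.
Proof.
move=> /= F mF tF mUF; rewrite /density_mass ge0_integral_bigcup//=; last first.
- by move=> e _; rewrite lee_fin.
- by apply/measurable_EFinP; exact: measurable_funTS.
apply: is_cvg_ereal_nneg_natsum_cond => n _ _.
by apply: integral_ge0 => e _; rewrite lee_fin.
Qed.

Definition density_measure : {measure set R -> \bar R} :=
  HB.pack density_mass (isMeasure.Build _ _ R density_mass
    mdens0 mdens_ge0 mdens_sigma_additive).

(** Open left rays are stable under intersection, generate the Borel sets and exhaust the line. *)
Lemma measure_unique_rays (m1 m2 : {measure set R -> \bar R}) :
  (m1 setT < +oo)%E -> (forall c, m1 `]-oo, c[%classic = m2 `]-oo, c[%classic) ->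
  forall B, measurable B -> m1 B = m2 B.
Proof.
move=> m1oo m12 B mB.
apply: (@measure_unique _ R R (@RGenInftyO.G R)
  (fun n => `]-oo, n%:R[%classic) _ _ _ _ m1 m2) => //.
- exact: RGenInftyO.measurableE.
- move=> _ _ [x ->] [y ->]; exists (Num.min x y).
  by apply/seteqP; split=> z /=; rewrite !in_itv /= lt_min => /andP.
- by move=> n; exists n%:R.
- apply/seteqP; split=> // x _; exists (Num.truncn x).+1 => //=.
  by rewrite in_itv /= truncnS_gt.
- by move=> _ [c ->].
- by move=> n; apply: le_lt_trans m1oo; apply: le_measure; rewrite ?inE.
Qed.

End density_measure.

Section determination.
Context d (T : measurableType d) (R : realType) (mu : {measure set T -> \bar R}).
Variables (K : set T) (f : T -> R) (dn : R -> R).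
Hypotheses (mu1 : mu setT = 1%E) (mK : measurable K) (muK : mu (~` K) = 0%E).
Hypotheses (mf : measurable_fun setT f) (fK : forall g, K g -> 0 <= f g <= 8).
Hypotheses (mdn : measurable_fun setT dn) (dn_ge0 : forall e, 0 <= dn e).
Hypothesis dn_out : forall e, ~~ (0 <= e <= 8) -> dn e = 0.
Local Notation leb := (@lebesgue_measure R).
Hypothesis same_moments : forall q : {poly R},
  (forall s, -4 <= s <= 4 -> 0 <= q.[s]) ->
  (\int[mu]_g (q.[f g - 4])%:E = \int[leb]_e (q.[e - 4] * dn e)%:E)%E.

Let integral_dn : (\int[leb]_e (dn e)%:E = 1)%E.
Proof.
have q1 : forall s : R, -4 <= s <= 4 -> 0 <= (1 : {poly R}).[s].
  by move=> s _; rewrite hornerC.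
have := same_moments q1.
under eq_integral do rewrite hornerC.
rewrite integral_cst// mu1 mule1 => ->.
by apply: eq_integral => e _; rewrite hornerC mul1r.
Qed.

Let integrable_dn : leb.-integrable setT (EFin \o dn).
Proof.
apply/integrableP; split; first exact/measurable_EFinP.
under eq_integral do rewrite /= ger0_norm//.
by rewrite integral_dn ltry.
Qed.

(** Threshold polynomials are nonnegative on [-4, 4], so [same_moments] applies to each. Dominated
    convergence, with bounds 1 on the group and [dn] on the line, passes to the indicator of the
    ray. *)
Lemma determination_ray c :
  mu [set g | f g < c] = (\int[leb]_(e in `]-oo, c[) (dn e)%:E)%E.
Proof.
pose L := 4 + `|c - 4|; have cL : 4 + `|c - 4| <= L by [].
pose q n := threshold_poly L (c - 4) n.
have q01 n s : -4 <= s <= 4 -> 0 <= (q n).[s] <= 1 by exact: threshold_poly_itv01.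
have mc : measurable [set g | f g < c].
  by rewrite -[X in measurable X]setTI -preimage_itvNyo; apply: mf.
have mq n : measurable_fun setT (fun s : R => (q n).[s - 4]).
  apply: (measurableT_comp (f := horner (q n))).
    by apply: continuous_measurable_fun; exact: continuous_horner.
  exact: measurable_funB.
have aeK (P : T -> Prop) : (forall g, K g -> P g) -> {ae mu, forall g, P g}.
  move=> KP; exists (~` K); split; [exact: measurableC|exact: muK|].
  by move=> g /= nP Kg; apply: nP; exact: KP.
have shift (e : R) : 0 <= e <= 8 -> -4 <= e - 4 <= 4.
  by move=> /andP[? ?]; apply/andP; split; lra.
have lhs : (\int[mu]_g ((q n).[f g - 4])%:E @[n --> \oo] -->
    \int[mu]_g ((f g < c)%R%:R : R)%:E)%E.
  have [|||||_ _ h] := @dominated_convergence _ _ _ mu setT measurableT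
    (fun n g => ((q n).[f g - 4])%:E) (fun g => ((f g < c)%R%:R : R)%:E) (cst 1%E).
  - move=> n; apply/measurable_EFinP.
    exact: (measurableT_comp (f := fun s : R => (q n).[s - 4])).
  - apply/measurable_EFinP.
    rewrite (_ : (fun g => _) = \1_[set g | f g < c]); first exact: measurable_indic.
    by apply/funext => g; rewrite indicE mem_setE.
  - apply: aeK => g Kg _; apply: cvg_EFin; first exact: nearW.
    rewrite -(ltrD2r (-4) (f g)); apply: cvg_threshold_poly => //.
    exact/shift/fK.
  - exact: (bounded_on_integrable mu1 mK muK (bounded_on_cst K 1)).
  - apply: aeK => g Kg n _; rewrite lee_fin.
    by have /andP[q0 q1] := q01 n _ (shift _ (fK Kg)); rewrite ger0_norm.
  exact: h.
have rhs : (\int[leb]_e ((q n).[e - 4] * dn e)%:E @[n --> \oo] -->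
    \int[leb]_e ((e < c)%R%:R * dn e)%:E)%E.
  have [|||||_ _ h] := @dominated_convergence _ _ _ leb setT measurableT
    (fun n e => ((q n).[e - 4] * dn e)%:E) (fun e => ((e < c)%R%:R * dn e)%:E)
    (EFin \o dn).
  - by move=> n; apply/measurable_EFinP; apply: measurable_funM; first exact: mq.
  - apply/measurable_EFinP; apply: measurable_funM => //.
    rewrite (_ : (fun e => _) = \1_[set e : R | e < c]).
      by apply: measurable_indic; rewrite -set_itvNyo; exact: measurable_itv.
    by apply/funext => e; rewrite indicE mem_setE.
  - apply: aeW => e _; apply: cvg_EFin; first exact: nearW.
    have [/shift e8|/dn_out ->] := boolP (0 <= e <= 8); last first.
      by under eq_fun do rewrite mulr0; rewrite mulr0; exact: cvg_cst.
    apply: cvgM; last exact: cvg_cst.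
    by rewrite -(ltrD2r (-4) e); exact: cvg_threshold_poly.
  - exact: integrable_dn.
  - apply: aeW => e n _; rewrite /= lee_fin normrM (ger0_norm (dn_ge0 e)).
    have [/shift e8|/dn_out ->] := boolP (0 <= e <= 8); last by rewrite mulr0.
    by have /andP[q0 q1] := q01 n _ e8; rewrite ger0_norm// ler_piMl.
  exact: h.
have lr : (fun n => \int[mu]_g ((q n).[f g - 4])%:E)%E =
    (fun n => \int[leb]_e ((q n).[e - 4] * dn e)%:E)%E.
  by apply/funext => n; apply: same_moments => s /(q01 n)/andP[].
rewrite -lr in rhs.
have := cvg_unique (@ereal_hausdorff R) lhs rhs.
under eq_integral => g _.
  rewrite (_ : (f g < c)%R%:R = \1_[set g | f g < c] g); last first.
    by rewrite indicE mem_setE.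
  over.
rewrite integral_indic// setIT => ->.
rewrite [RHS]integral_mkcond; apply: eq_integral => e _.
by rewrite patchE mem_setE in_itv /=; case: ifPn => _; rewrite ?mul1r ?mul0r.
Qed.

Lemma determination (B : set R) : measurable B ->
  mu (f @^-1` B) = (\int[leb]_(e in B) (dn e)%:E)%E.
Proof.
move=> mB.
have := @measure_unique_rays R (pushforward mu f) (density_measure mdn dn_ge0).
apply=> //; first by rewrite /= /pushforward preimage_setT mu1 ltry.
move=> c; apply: etrans (determination_ray c).
by rewrite /= /pushforward set_itvNyo.
Qed.

End determination.

(** * Behaviour at the edge *)

Section density_asymptotics.
Variable R : realType.
Local Notation leb := (@lebesgue_measure R).
Variables al be : R.
Hypotheses (al0 : 0 <= al) (be0 : 0 <= be).

Lemma trace_density_out e : ~~ (0 <= e <= 8) -> trace_density al be e = 0.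
Proof.
move=> e8; rewrite /trace_density /semiE (_ : (fun x => _) = fun=> 0).
  by rewrite Rintegral_cst// mul0r.
apply/funext => x.
have [xI|xI] := boolP (x \in `[-2, 2]); last by rewrite (semi_pdf_out xI) mulr0.
have [yI|yI] := boolP (e - 4 - x \in `[-2, 2]); last first.
  by rewrite (semi_pdf_out yI) mulr0 mul0r.
exfalso; move: e8 xI yI; rewrite negb_and -!ltNge !in_itv /=.
by case/orP => ? /andP[? ?] /andP[? ?]; lra.
Qed.

Lemma semiE_le (f g : R -> R) : continuous f -> continuous g ->
  (forall z, -2 <= z <= 2 -> f z <= g z) -> semiE f <= semiE g.
Proof.
move=> cf cg fg; apply: le_Rintegral => //; try exact: integrable_semi_pdf.
move=> z _; have [zI|zI] := boolP (z \in `[-2, 2]); last first.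
  by rewrite (semi_pdf_out zI) !mulr0.
by rewrite ler_wpM2r ?semi_pdf_ge0// fg.
Qed.

(** After the edge substitution each of 4 - x^2 and 4 - y^2 is e/4 (2 + z) or e/4 (2 - z) times a
    factor close to 4; this is the square root of the product of those two factors. *)
Definition edge_root (e z : R) : R :=
  Num.sqrt ((4 - e / 4 * (2 + z)) * (4 - e / 4 * (2 - z))).

Definition edge_weyl (e z : R) : R := al + be * (e ^+ 2 / 8) * z ^+ 2.

Lemma continuous_edge_weyl e : continuous (edge_weyl e).
Proof.
move=> z; apply: cvgD; first exact: cvg_cst.
by apply: cvgM; [exact: cvg_cst|exact: exprn_continuous].
Qed.

Lemma continuous_edge_root e : continuous (edge_root e).
Proof.
move=> z; apply: (@continuous_comp _ _ _
  (fun z : R => (4 - e / 4 * (2 + z)) * (4 - e / 4 * (2 - z))) Num.sqrt).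
  apply: cvgM; apply: cvgB; try exact: cvg_cst; apply: cvgM; try exact: cvg_cst.
    by apply: cvgD; [exact: cvg_cst|exact: cvg_id].
  by apply: cvgB; [exact: cvg_cst|exact: cvg_id].
exact: sqrt_continuous.
Qed.

Lemma semiE_edge_weyl e : semiE (edge_weyl e) = al + be * (e ^+ 2 / 8).
Proof.
have c2 : semimom R 2 = 1.
  by have := semimomS R 0; rewrite semimom0; lra.
have -> : edge_weyl e = fun z => al * z ^+ 0 + be * (e ^+ 2 / 8) * z ^+ 2.
  by apply/funext => z; rewrite expr0 mulr1.
rewrite semiED; try (move=> z; apply: cvgM; [exact: cvg_cst|exact: exprn_continuous]).
rewrite !semiEZ; try exact: exprn_continuous.
by rewrite -!/(semimom _ _) semimom0 c2 !mulr1.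
Qed.

(** The radicand is 16 - 4 e + (e^2 / 16) (4 - z^2): up to first order in e it does not depend on z
    and agrees with (4 - e/2)^2. *)
Lemma edge_root_bounds e z : 0 < e < 1 -> -2 <= z <= 2 ->
  4 - e / 2 - e ^+ 2 <= edge_root e z <= 4 - e / 2.
Proof.
move=> /andP[e0 e1] /andP[z1 z2].
have z4 : 0 <= (2 + z) * (2 - z) by rewrite mulr_ge0//; lra.
have z4' : (2 + z) * (2 - z) <= 4 by have := sqr_ge0 z; lra.
have b0 : 0 <= 4 - e / 2 by lra.
have b1 : 0 <= 4 - e / 2 - e ^+ 2 by nra.
have e2 := sqr_ge0 e.
rewrite -[X in X <= edge_root _ _](ger0_norm b1) -[X in _ && (_ <= X)](ger0_norm b0).
rewrite -!sqrtr_sqr !ler_wsqrtr//.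
  have -> : (4 - e / 4 * (2 + z)) * (4 - e / 4 * (2 - z)) =
    16 - 4 * e + e ^+ 2 / 16 * ((2 + z) * (2 - z)) by field.
  by move: ((2 + z) * (2 - z)) z4' => u u4; nra.
have -> : (4 - e / 4 * (2 + z)) * (4 - e / 4 * (2 - z)) =
  16 - 4 * e + e ^+ 2 / 16 * ((2 + z) * (2 - z)) by field.
have : 0 <= e ^+ 2 / 16 * ((2 + z) * (2 - z)) by rewrite mulr_ge0// divr_ge0.
have : e ^+ 2 * (1 / 4 - 8 + e + e ^+ 2) <= 0.
  rewrite mulr_ge0_le0//; nra.
move: (e ^+ 2 / 16 * _) => u h1 h2; nra.
Qed.

(* The substitution [x = e / 4 * z + (e / 2 - 2)] turns the edge of the
   convolution integral into a semicircle integral in [z]. *)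
Lemma trace_density_edge e : 0 < e < 1 ->
  trace_density al be e = e ^+ 2 / (32 * pi) * semiE (fun z => edge_weyl e z * edge_root e z).
Proof.
move=> /andP[e0 e1]; have pi0 : pi != 0 :> R by rewrite gt_eqF// pi_gt0.
have c1 := @continuous_dens_integrand R al be (e - 4).
have c2 : continuous (fun z => edge_weyl e z * edge_root e z).
  by move=> z; apply: cvgM; [exact: continuous_edge_weyl|exact: continuous_edge_root].
apply/EFin_inj; rewrite /trace_density -integral_semi_pdf// -semiEZ//.
rewrite -integral_semi_pdf; last first.
  by move=> z; apply: cvgM; [exact: cvg_cst|exact: c2].
rewrite (@integral_affine _ _ (e / 4) (e / 2 - 2)); last 3 first.
- by rewrite divr_gt0.
- by move=> x; apply: cvgM; [exact: c1|exact: continuous_semi_pdf].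
- move=> x; rewrite mulr_ge0 ?semi_pdf_ge0// mulr_ge0 ?semi_pdf_ge0//.
  exact: weyl_ge0.
apply: eq_integral => z _; congr EFin.
set x := e / 4 * z + (e / 2 - 2).
have -> : weyl al be x (e - 4 - x) = edge_weyl e z.
  by rewrite /weyl /edge_weyl /x; field.
(* The prefactor e^2 / (32 pi) collects e/4 from the Jacobian, e/4 from the two square roots, and
   one 1 / (2 pi) left after forming the density in z. *)
suff h : semi (e - 4 - x) * semi x = e / 4 * (semi z * edge_root e z).
  transitivity (e / 4 * edge_weyl e z * (semi (e - 4 - x) * semi x) / (2 * pi) / (2 * pi)).
    by rewrite /semi_pdf; move: (pi : R) pi0 => p p0; field.
  by rewrite h /semi_pdf; move: (pi : R) pi0 => p p0; field.
(* Outside [-2, 2] both sides are zero: z < -2 gives x < -2, and z > 2 gives y < -2. *)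
have [zI|zI] := boolP (z \in `[-2, 2]); last first.
  rewrite (semi_out zI) mul0r mulr0; move: zI.
  rewrite in_itv /= negb_and -!ltNge => /orP[z2|z2].
    rewrite (@semi_out _ x) ?mulr0// in_itv /= negb_and -!ltNge; apply/orP; left.
    by rewrite /x; nra.
  rewrite (@semi_out _ (e - 4 - x)) ?mul0r// in_itv /= negb_and -!ltNge.
  by apply/orP; left; rewrite /x; nra.
move: zI; rewrite in_itv /= => /andP[z1 z2].
have p1 : 0 <= 4 - e / 4 * (2 + z) by nra.
have p2 : 0 <= 4 - e / 4 * (2 - z) by nra.
have x4 : 0 <= 4 - (e - 4 - x) ^+ 2.
  have -> : 4 - (e - 4 - x) ^+ 2 = e / 4 * (2 - z) * (4 - e / 4 * (2 - z)).
    by rewrite /x; field.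
  by rewrite mulr_ge0// mulr_ge0// ?divr_ge0//; lra.
rewrite /semi /edge_root -(sqrtrM (4 - x ^+ 2) x4).
have z4 : 0 <= 4 - z ^+ 2 by nra.
rewrite -(sqrtrM _ z4).
set U := (X in _ = _ * Num.sqrt X).
have -> : e / 4 * Num.sqrt U = Num.sqrt ((e / 4) ^+ 2 * U).
  by rewrite (sqrtrM U (sqr_ge0 (e / 4))) sqrtr_sqr ger0_norm// divr_ge0// ltW.
by congr Num.sqrt; rewrite /U /x; field.
Qed.

(** The bounds on the root are uniform in z, so the error is e^2 times the mean weight W, the second
    semicircle moment being 1. For USp(4), W is e^2 / 8, and the error gains two orders. *)
Lemma trace_density_asymp e : 0 < e < 1 ->
  `|trace_density al be e - e ^+ 2 * (8 - e) / (64 * pi) * (al + be * (e ^+ 2 / 8))| <=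
  e ^+ 4 / (32 * pi) * (al + be * (e ^+ 2 / 8)).
Proof.
move=> e01; have /andP[e0 e1] := e01; have pi0 := pi_gt0 R.
have pin : pi != 0 :> R by rewrite gt_eqF.
set W := al + _.
have cw := @continuous_edge_weyl e; have cr := @continuous_edge_root e.
have wz z : 0 <= edge_weyl e z.
  by rewrite addr_ge0// mulr_ge0 ?sqr_ge0// mulr_ge0// divr_ge0// sqr_ge0.
have cwr : continuous (fun z => edge_weyl e z * edge_root e z).
  by move=> z; apply: cvgM; [exact: cw|exact: cr].
have cwZ k : continuous (fun z => k * edge_weyl e z).
  by move=> z; apply: cvgM; [exact: cvg_cst|exact: cw].
set I := semiE (fun z => edge_weyl e z * edge_root e z).
have WE : W = semiE (edge_weyl e) by rewrite semiE_edge_weyl.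
have up : I <= (4 - e / 2) * W.
  rewrite WE -semiEZ//; apply: semiE_le => // z zI.
  by have /andP[_ h] := edge_root_bounds e01 zI; rewrite mulrC ler_wpM2r.
have lo : (4 - e / 2 - e ^+ 2) * W <= I.
  rewrite WE -semiEZ//; apply: semiE_le => // z zI.
  by have /andP[h _] := edge_root_bounds e01 zI; rewrite [leRHS]mulrC ler_wpM2r.
rewrite trace_density_edge// -/I.
have -> : e ^+ 2 / (32 * pi) * I - e ^+ 2 * (8 - e) / (64 * pi) * W =
  e ^+ 2 / (32 * pi) * (I - (4 - e / 2) * W).
  by move: (pi : R) pin => p p0; field.
have -> : e ^+ 4 / (32 * pi) * W = e ^+ 2 / (32 * pi) * (e ^+ 2 * W).
  by move: (pi : R) pin => p p0; field.
have k0 : 0 <= e ^+ 2 / (32 * pi) by rewrite divr_ge0 ?sqr_ge0// mulr_ge0// ltW.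
rewrite normrM (ger0_norm k0) ler_wpM2l// ler_norml; apply/andP; split; lra.
Qed.

End density_asymptotics.

(** * The law of the shifted trace *)

Section main.
Variables (R : realType) (K : set (MX4 R)) (mu : {measure set (MX4 R) -> \bar R}).
Variables al be : R.
Hypotheses (al0 : 0 <= al) (be0 : 0 <= be).
Hypotheses (mK : measurable K) (KU : K `<=` @USp4 R) (hmu : haar_prob K mu).
Hypothesis moments : forall n,
  (\int[mu]_g ((trul g + trdr g) ^+ n))%R = weylmom al be n.

Lemma measurable_epsf : measurable_fun setT (@epsf R : MX4 R -> R).
Proof.
apply: measurable_funD => //.
have [] // : cmeasurable (fun g : MX4 R => \tr g).
by apply: cmeasurable_sum => i; exact: cmeasurable_entry.
Qed.

Lemma epsfE g : K g -> epsf g = trul g + trdr g + 4.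
Proof. by move=> /KU /USp4_coords[_ _]; rewrite /epsf => ->. Qed.

Lemma epsf_bounds g : K g -> 0 <= epsf g <= 8.
Proof.
move=> Kg; rewrite epsfE// /trul /trdr.
have [[h1 _ _ _] [h2 _]] := column_bounded KU Kg.
have b (z : complex R) : normsq z <= 1 -> -1 <= complex.Re z <= 1.
  move=> z1; rewrite -ler_norml; apply: (le1_normr (sqr_ge0 (complex.Im z))).
  exact: z1.
have /andP[? ?] := b _ h1; have /andP[? ?] := b _ h2.
by apply/andP; split; lra.
Qed.

(** On [K] the shifted trace is [trul + trdr + 4], so the integrals of a polynomial agree almost
    everywhere and follow by linearity from the power moments. *)
Lemma push_eps_density (B : set R) : measurable B ->
  push_eps mu B = (\int[lebesgue_measure]_(e in B) (trace_density al be e)%:E)%E.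
Proof.
have [mu1 [muK _]] := hmu.
apply: (determination mu1 mK muK measurable_epsf epsf_bounds
  (measurable_trace_density al0 be0) (trace_density_ge0 al0 be0)
  (@trace_density_out R al be)) => q q0.
rewrite trace_density_moments//.
have bt := bounded_trace KU.
have bq (i : 'I_(size q)) : bounded_on K
    (fun g : MX4 R => q`_i * (trul g + trdr g) ^+ i).
  by apply: bounded_onM; [exact: bounded_on_cst|exact: bounded_onX].
transitivity (\int[mu]_g (\sum_(i < size q) q`_i * (trul g + trdr g) ^+ i)%:E)%E.
  apply: ae_eq_integral => //.
  - apply/measurable_EFinP; apply: (measurableT_comp (f := fun s : R => q.[s - 4])).
      apply: (measurableT_comp (f := horner q)).
        by apply: continuous_measurable_fun; exact: continuous_horner.
      exact: measurable_funB.
    exact: measurable_epsf.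
  - by apply/measurable_EFinP; exact: (bounded_on_sum bq).1.
  exists (~` K); split=> //; first exact: measurableC.
  move=> g /= h Kg; apply: h => _; congr EFin.
  by rewrite epsfE// addrK horner_coef.
transitivity ((\int[mu]_g (\sum_(i < size q) q`_i * (trul g + trdr g) ^+ i))%R)%:E.
  rewrite /Rintegral fineK//; apply: integrable_fin_num => //.
  exact: (bounded_on_integrable mu1 mK muK (bounded_on_sum bq)).
rewrite (as_Rintegral_sum mu1 mK muK bq); congr EFin; apply: eq_bigr => i _.
by rewrite (as_RintegralZl mu1 mK muK) ?moments//; exact: bounded_onX.
Qed.

End main.

Theorem theorem6 (R : realType)
    (muG muH : {measure set (MX4 R) -> \bar R}) :
  haar_prob (@USp4 R) muG -> haar_prob (@Hsub R) muH ->
  density_asymp (push_eps muG)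
    (fun e => e ^+ 4 * (8 - e) / (512 * pi)) 6 /\
  density_asymp (push_eps muH)
    (fun e => e ^+ 2 * (8 - e) / (64 * pi)) 4.
Proof.
move=> hG hH; have pi0 := pi_gt0 R.
have pin : pi != 0 :> R by rewrite gt_eqF.
have c0 := semimom0 R; have c1 := semimom1 R; have cS := @semimomS R.
split.
  have mG n : (\int[muG]_g ((trul g + trdr g) ^+ n))%R = weylmom 0 1 n.
    by rewrite (USp4_trace_moment c0 c1 cS _ hG) /weylmom mul0r mul1r add0r.
  (* The edge estimate holds for 0 < e < 1, so 1/2 serves as radius; 256 = 32 * 8 combines its
     constant with the weight e^2 / 8. *)
  exists (trace_density 0 1), 2^-1, (256 * pi)^-1; split; first by [].
  split; first exact: measurable_funTS (measurable_trace_density _ _).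
  split=> [B mB _|e /andP[e0 e1]].
    exact: (push_eps_density (lexx 0) ler01 (@measurable_USp4 R) _ hG mG mB).
  have e01 : 0 < e < 1 by rewrite e0 /=; lra.
  have := trace_density_asymp (lexx 0) ler01 e01; rewrite !add0r !mul1r.
  have -> : e ^+ 2 * (8 - e) / (64 * pi) * (e ^+ 2 / 8) =
    e ^+ 4 * (8 - e) / (512 * pi) by move: (pi : R) pin => p p0; field.
  suff -> : e ^+ 4 / (32 * pi) * (e ^+ 2 / 8) = (256 * pi)^-1 * e ^+ 6 by [].
  by move: (pi : R) pin => p p0; field.
have mH n : (\int[muH]_g ((trul g + trdr g) ^+ n))%R = weylmom 1 0 n.
  by rewrite (Hsub_trace_moment c0 c1 cS _ hH) /weylmom mul0r mul1r addr0.
exists (trace_density 1 0), 2^-1, (32 * pi)^-1; split; first by [].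
split; first exact: measurable_funTS (measurable_trace_density _ _).
split=> [B mB _|e /andP[e0 e1]].
  exact: (push_eps_density ler01 (lexx 0) (@measurable_Hsub R) (@Hsub_USp4 R) hH mH mB).
have e01 : 0 < e < 1 by rewrite e0 /=; lra.
have := trace_density_asymp ler01 (lexx 0) e01; rewrite mul0r addr0 !mulr1.
by rewrite [_^-1 * _]mulrC.
Qed.
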